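(* Let $N\ge1$ and let $\mathbf x=(\vec x,\vec a)$ be a configuration of $N$ shock markers, with positions $x_1<\dots<x_N$ in $\mathbb Z$ and colours $a_1,\dots,a_N\in\{0,\dots,n-1\}$. Let $\nu_{\mathbf x}(t)$ denote the distribution at time $t$ of the $n$-priority ASEP on $\mathbb Z$ started from the shock measure $\nu_{\mathbf x}$. Then for all $t\ge0$ $$\nu_{\mathbf x}(t)=\sum_{\mathbf y}P(\mathbf y,t\,|\,\mathbf x,0)\,\nu_{\mathbf y},$$ where the sum is over all configurations $\mathbf y$ of $N$ shock markers and $P(\mathbf y,t|\mathbf x,0)$ is the transition probability of the shock exclusion process with $N$ particles.
   Context: Fix an integer $n\ge1$ and reals $w>0$, $q>1$, $\lambda\in\mathbb R$. $n$-priority ASEP on $\mathbb Z$: the Markov process on $\{0,\dots,n\}^{\mathbb Z}$ with generator (on cylinder functions) $\mathcal Lf(\eta)=\sum_{k\in\mathbb Z}w\big(q^{\operatorname{sgn}(\eta_k-\eta_{k+1})}-\delta_{\eta_k,\eta_{k+1}}\big)[f(\eta^{kk+1})-f(\eta)]$, where $\eta^{kk+1}$ is $\eta$ with the values at $k,k+1$ interchanged and $\operatorname{sgn}(0)=0$. Densities: for $0\le j\le N$, $\rho_j=\dfrac{q^{2j-N+\lambda}}{1+q^{2j-N+\lambda}}$. Shock measure: for $\mathbf x=(\vec x,\vec a)$, $\nu_{\mathbf x}$ is the product measure on $\{0,\dots,n\}^{\mathbb Z}$ such that $\eta_{x_j}=a_j$ with probability 1 for $1\le j\le N$, and for every site $k\notin\{x_1,\dots,x_N\}$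 with $x_j<k<x_{j+1}$ ($0\le j\le N$, $x_0=-\infty$, $x_{N+1}=+\infty$) one has $\eta_k=n$ with probability $\rho_j$ and $\eta_k=0$ with probability $1-\rho_j$. Shock exclusion process with $N$ particles: the continuous-time Markov chain on the configurations $\mathbf x=(\vec x,\vec a)$ with the following transitions. (1) Jumps: for $1\le i\le N$, $x_i\to x_i\pm1$ (all else unchanged) at rate $w\,v_i^{\pm1}(1-\delta_{x_{i\pm1},x_i\pm1})$, where $$v_i=\frac{(q-q^{-1})\rho_i(1-\rho_i)}{\rho_i-\rho_{i-1}},\qquad v_i^{-1}=\frac{(q-q^{-1})\rho_{i-1}(1-\rho_{i-1})}{\rho_i-\rho_{i-1}}.$$ (2) Colour exchange: for $1\le i\le N-1$, the colours $a_i$ and $a_{i+1}$ are interchanged (positions unchanged) at rate $$\Big[w\big(q^{\operatorname{sgn}(a_{i+1}-a_i)}-\delta_{a_i,a_{i+1}}\big)(1-\delta_{a_i,0})(1-\delta_{a_{i+1},0})+wq(1-\delta_{a_i,0})\delta_{a_{i+1},0}+wq^{-1}\delta_{a_i,0}(1-\delta_{a_{i+1},0})\Big]\delta_{x_{i+1},x_i+1}.$$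
   Formalization: In the colour exchange rate for two nonzero colours the exponent is sgn(a_i − a_{i+1}) instead of the printed sgn(a_{i+1} − a_i), which makes the claim false for adjacent markers with distinct nonzero colours (n ≥ 3, N ≥ 2). *)

(* Defs.v *)
From HB Require Import structures.
From mathcomp Require Import all_boot all_order all_algebra.
From mathcomp Require Import all_classical all_reals all_analysis.
From mathcomp Require Import ring lra.

Set Implicit Arguments.
Unset Strict Implicit.
Unset Printing Implicit Defensive.
Import Order.TTheory GRing.Theory Num.Theory.
Import numFieldNormedType.Exports.

Local Open Scope classical_set_scope.
Local Open Scope ring_scope.

HB.instance Definition _ (n : nat) := isPointed.Build 'I_n.+1 ord0.

Definition coord_sets (n : nat) : set (set (int -> 'I_n.+1)) :=
  [set A | exists k a, A = [set eta | eta k = a]].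

(* [{0..n}^Z] with the product sigma-algebra *)
Definition config (n : nat) : measurableType _ :=
  g_sigma_algebraType (@coord_sets n).

(* [{0..n}^Z] with the product topology of the discrete spaces [{0..n}] *)
Definition config_top (n : nat) : topologicalType :=
  {ptws int -> discrete_topology 'I_n.+1}.

Definition continuous_obs (R : realType) (n : nat) (f : config n -> R) : Prop :=
  continuous (f : config_top n -> R).

Definition cylinder (R : realType) (n : nat) (f : config n -> R) : Prop :=
  exists S : seq int, forall eta zeta : config n,
    (forall k, k \in S -> eta k = zeta k) -> f eta = f zeta.

Definition exchange (n : nat) (k : int) (eta : config n) : config n :=
  fun j => if j == k then eta (k + 1) else if j == k + 1 then eta k else eta j.

(* On a cylinder function only finitely many terms are nonzero, so the
   finite-support sum over [Z] is the sum in the definition of the generator. *)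
Definition asep_gen (R : realType) (n : nat) (w q : R) (f : config n -> R)
    (eta : config n) : R :=
  \sum_(k \in [set: int])
    w * (q ^ sgz ((eta k : nat)%:Z - (eta (k + 1) : nat)%:Z)
         - (eta k == eta (k + 1))%:R)
      * (f (exchange k eta) - f eta).

Definition kernel_op (R : realType) (n : nat)
    (P : R -> R.-pker (config n) ~> (config n)) (t : R) (f : config n -> R) :
    config n -> R :=
  fun eta => \int[P t eta]_zeta f zeta.

(* Transition kernels [P t], [t >= 0], of a Feller process. *)
Record feller_process (R : realType) (n : nat)
    (P : R -> R.-pker (config n) ~> (config n)) : Prop := FellerProcess {
  feller_init : forall (eta : config n) (A : set (config n)),
    measurable A -> P 0 eta A = \d_eta A ;
  feller_chapman_kolmogorov : forall (s t : R) (eta : config n)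
      (A : set (config n)), 0 <= s -> 0 <= t -> measurable A ->
    P (s + t) eta A = (\int[P s eta]_zeta P t zeta A)%E ;
  feller_continuous : forall (t : R) (f : config n -> R), 0 <= t ->
    continuous_obs f -> continuous_obs (kernel_op P t f) ;
  feller_strongly_continuous : forall f : config n -> R, continuous_obs f ->
    {uniform, kernel_op P t f @[t --> 0^'+] --> f} }.

(* The process generated by [asep_gen], given on cylinder functions, where the
   generator is the derivative at [0+] of the semigroup in the uniform norm. *)
Definition priority_asep (R : realType) (n : nat) (w q : R)
    (P : R -> R.-pker (config n) ~> (config n)) : Prop :=
  feller_process P /\
  forall f : config n -> R, cylinder f ->
    {uniform, (fun eta => (kernel_op P t f eta - f eta) / t) @[t --> 0^'+]
       --> asep_gen w q f}.

Definition law_at (R : realType) (n : nat)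
    (P : R -> R.-pker (config n) ~> (config n))
    (mu : probability (config n) R) (t : R) (A : set (config n)) : \bar R :=
  (\int[mu]_eta P t eta A)%E.

(* Markers are numbered from 0: [i : 'I_N] is the (i+1)-st marker. *)
Definition increasing_pos (N : nat) (x : {ffun 'I_N -> int}) : bool :=
  [forall i : 'I_N, forall j : 'I_N, (i < j)%N ==> (x i < x j)].

Definition shock_config (n N : nat) : choiceType :=
  {c : {ffun 'I_N -> int} * {ffun 'I_N -> 'I_n} | increasing_pos c.1}.

Definition pos (n N : nat) (x : shock_config n N) : {ffun 'I_N -> int} :=
  (val x).1.
Definition colour (n N : nat) (x : shock_config n N) : {ffun 'I_N -> 'I_n} :=
  (val x).2.

Definition rho (R : realType) (q lambda : R) (N j : nat) : R :=
  let z := q `^ (2 * j%:R - N%:R + lambda) in z / (1 + z).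

(* [k] lies strictly between the [j]-th and the [j+1]-st marker (numbered from
   1), where the 0-th and the [N+1]-st are at [-oo] and [+oo]. *)
Definition in_gap (n N : nat) (x : shock_config n N) (j : nat) (k : int) :=
  forall i : 'I_N,
    ((i < j)%N -> pos x i < k) /\ ((j <= i)%N -> k < pos x i).

Record shock_measure (R : realType) (n N : nat) (q lambda : R)
    (x : shock_config n N) (nu : probability (config n) R) : Prop :=
  ShockMeasure {
  shock_product : forall (S : seq int) (xi : config n), uniq S ->
    nu [set eta : config n | forall k, k \in S -> eta k = xi k] =
    (\prod_(k <- S) nu [set eta : config n | eta k = xi k])%E ;
  shock_marker : forall i : 'I_N,
    nu [set eta : config n | eta (pos x i) = colour x i :> nat] = 1%E ;
  shock_bulk : forall (j : nat) (k : int), (j <= N)%N -> in_gap x j k ->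
    nu [set eta : config n | eta k = ord_max] = (rho q lambda N j)%:E /\
    nu [set eta : config n | eta k = ord0] = (1 - rho q lambda N j)%:E }.

(* [shock_v q lambda N i] is the [v] of the marker [i : 'I_N], hence the indices
   [i.+1] and [i] of the densities to its right and to its left. *)
Definition shock_v (R : realType) (q lambda : R) (N i : nat) : R :=
  (q - q^-1) * rho q lambda N i.+1 * (1 - rho q lambda N i.+1)
  / (rho q lambda N i.+1 - rho q lambda N i).

Lemma shock_vV (R : realType) (q lambda : R) (N i : nat) : 1 < q ->
  (shock_v q lambda N i)^-1 =
  (q - q^-1) * rho q lambda N i * (1 - rho q lambda N i)
  / (rho q lambda N i.+1 - rho q lambda N i).
Proof.
move=> q1; have q0 : 0 < q by rewrite (lt_trans ltr01).
rewrite /shock_v /rho.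
have -> : 2 * i.+1%:R - N%:R + lambda = 2%:R + (2 * i%:R - N%:R + lambda).
  by rewrite -natr1; ring.
rewrite powRD; last by rewrite (gt_eqF q0) implybT.
rewrite powR_mulrn ?ltW //.
set z := q `^ _; have z0 : 0 < z by exact: powR_gt0.
have q2 : q ^+ 2 - 1 != 0 by rewrite subr_eq0 gt_eqF// exprn_egt1.
field.
have pz : q ^+ 2 * z > 0 by rewrite mulr_gt0// exprn_gt0.
have d : q ^+ 2 * z * (1 + z) + - z * (1 + q ^+ 2 * z) = z * (q ^+ 2 - 1)
  by ring.
rewrite d mulf_neq0 ?(gt_eqF z0)// addrK oner_eq0 -expr2 q2 (gt_eqF q0) /=.
by rewrite !gt_eqF// addr_gt0.
Qed.

Definition jump (n N : nat) (x : shock_config n N) (i : 'I_N) (d : int) :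
    {ffun 'I_N -> int} * {ffun 'I_N -> 'I_n} :=
  ([ffun j => if j == i then pos x i + d else pos x j], colour x).

Definition swap_col (n N : nat) (x : shock_config n N) (i j : 'I_N) :
    {ffun 'I_N -> int} * {ffun 'I_N -> 'I_n} :=
  (pos x, [ffun k =>
    if k == i then colour x j else if k == j then colour x i else colour x k]).

Definition blocked_right (n N : nat) (x : shock_config n N) (i : 'I_N) : bool :=
  [exists j : 'I_N, (j == i.+1 :> nat) && (pos x j == pos x i + 1)].
Definition blocked_left (n N : nat) (x : shock_config n N) (i : 'I_N) : bool :=
  [exists j : 'I_N, (j.+1 == i :> nat) && (pos x j == pos x i - 1)].

(* Rate at which colours [a] and [b] of adjacent markers (left to right) are
   interchanged. The exponent in the first line is [sgn (a - b)], as in the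
   generator of the ASEP and in agreement with the two other lines: a larger
   colour moves to the right at rate [w q]. With [sgn (b - a)] the shock measures
   with distinct nonzero colours at adjacent sites would not evolve this way. *)
Definition swap_rate (R : realType) (w q : R) (a b : nat) : R :=
  w * (q ^ sgz (a%:Z - b%:Z) - (a == b)%:R) * (a != 0)%:R * (b != 0)%:R
  + w * q * (a != 0)%:R * (b == 0)%:R
  + w * q^-1 * (a == 0)%:R * (b != 0)%:R.

Definition shock_rate (R : realType) (n N : nat) (w q lambda : R)
    (x y : shock_config n N) : R :=
  \sum_(i < N) (
    w * shock_v q lambda N i * (~~ blocked_right x i)%:R
      * (val y == jump x i 1)%:R
    + w * (shock_v q lambda N i)^-1 * (~~ blocked_left x i)%:R
      * (val y == jump x i (-1))%:R)
  + \sum_(i < N) \sum_(j < N | j == i.+1 :> nat)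
      swap_rate w q (colour x i) (colour x j) * (pos x j == pos x i + 1)%:R
      * (val y == swap_col x i j)%:R.

Definition q_matrix (R : realType) (T : choiceType) (r : T -> T -> R)
    (x y : T) : R :=
  if y == x then - \sum_(z \in [set~ x]) r x z else r x y.

(* Transition probabilities [p t x y] (from [x] to [y] in time [t >= 0]) of the
   Markov chain with transition rates [r]. *)
Record ctmc (R : realType) (T : choiceType) (r : T -> T -> R)
    (p : R -> T -> T -> R) : Prop := CTMC {
  ctmc_ge0 : forall (t : R) x y, 0 <= t -> 0 <= p t x y ;
  ctmc_sum1 : forall (t : R) x, 0 <= t ->
    \esum_(y in [set: T]) (p t x y)%:E = 1%E ;
  ctmc_init : forall x y, p 0 x y = (y == x)%:R ;
  ctmc_chapman_kolmogorov : forall (s t : R) x y, 0 <= s -> 0 <= t ->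
    (p (s + t) x y)%:E =
    \esum_(z in [set: T]) (p s x z * p t z y)%:E ;
  ctmc_rates : forall x y,
    (p t x y - (y == x)%:R) / t @[t --> 0^'+] --> q_matrix r x y }.

(* Main.v *)
(** For a cylinder function [f] put [V f y = \int f d(nu y)]. Two facts give
    the theorem.

    Intertwining: [V (L f) = Q (V f)], where [L] is the generator of the
    exclusion process and [Q] that of the shock process. It holds bond by bond:
    the action of the bond [k, k+1] on [nu x] is the contribution of the shock
    transitions located at that bond plus [G k - G (k+1)]. Here [G k] is [nu x]
    with the marginal at [k] replaced by the signed measure
    [w (q - 1/q) rho (1 - rho) (delta_0 - delta_n)] if [k] is not a marker, and
    [0] otherwise. The differences telescope, and [G k] does not charge [f] when
    [k] is outside of the support of [f] because that signed measure has mass 0.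

    Uniqueness for small times: the support of [L^k f] grows by one site at each
    end with [k], so that [|L^k f| <= C K^k k!], and [|Q^k u| <= K^k |u|] as the
    rates of the shock process are bounded. The functions
    [s |-> V (P_s L^k f) x - Q^k (p_s V f) x] vanish at [0], and each one is the
    derivative of the previous one; such a growth forces them to vanish for
    [t < 1/K]. As [K] depends neither on [f] nor on [x], the identity holds for
    all measurable sets and then, by the semigroup property, for all times. *)

Require Import Defs.
From HB Require Import structures.
From mathcomp Require Import all_boot all_order all_algebra.
From mathcomp Require Import all_classical all_reals all_analysis.
From mathcomp Require Import perm measurable_realfun.
From mathcomp Require Import ring lra zify.
Import Order.TTheory GRing.Theory Num.Theory.
Import numFieldNormedType.Exports.
Local Open Scope classical_set_scope.
Local Open Scope ring_scope.

Set Implicit Arguments.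
Unset Strict Implicit.
Unset Printing Implicit Defensive.

(** * Taylor expansion with uniform right derivatives *)

Section UniformRightDerivative.
Variable R : realType.
Implicit Types (phi psi : R -> R).

(** The step [d] does not depend on [s], so an interval can be crossed in finitely many steps with
    one error rate. This takes the place of continuity and of a mean value theorem below. *)
Definition unif_rderiv phi phi' := forall e, 0 < e -> exists2 d, 0 < d &
  forall h s, 0 < h < d -> 0 <= s ->
    `|phi (s + h) - phi s - h * phi' s| <= e * h.

Lemma unif_rderiv0 : unif_rderiv (fun=> 0) (fun=> 0).
Proof.
move=> e e0; exists 1 => // h s /andP[h0 _] _.
by rewrite mulr0 !subr0 normr0 mulr_ge0 ?ltW.
Qed.

Lemma unif_rderivD phi phi' psi psi' :
  unif_rderiv phi phi' -> unif_rderiv psi psi' ->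
  unif_rderiv (fun s => phi s + psi s) (fun s => phi' s + psi' s).
Proof.
move=> H1 H2 e e0.
have e2 : 0 < e / 2 by rewrite divr_gt0.
have [d1 d10 {}H1] := H1 _ e2.
have [d2 d20 {}H2] := H2 _ e2.
exists (Num.min d1 d2) => [|h s]; first by rewrite lt_min d10.
rewrite lt_min => /and3P[h0 hd1 hd2] s0.
have {}H1 := H1 h s _ s0; have {}H2 := H2 h s _ s0.
rewrite h0 hd1 in H1; rewrite h0 hd2 in H2.
have -> : phi (s + h) + psi (s + h) - (phi s + psi s) - h * (phi' s + psi' s) =
  (phi (s + h) - phi s - h * phi' s) + (psi (s + h) - psi s - h * psi' s) by ring.
by rewrite (le_trans (ler_normD _ _))// [e]splitr mulrDl lerD ?H1 ?H2.
Qed.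

Lemma unif_rderivZ c phi phi' : unif_rderiv phi phi' ->
  unif_rderiv (fun s => c * phi s) (fun s => c * phi' s).
Proof.
move=> H e e0.
have c0 : 0 < `|c| + 1 by rewrite ltr_wpDl.
have [d d0 {}H] := H _ (divr_gt0 e0 c0).
exists d => // h s hd s0.
have -> : c * phi (s + h) - c * phi s - h * (c * phi' s) =
  c * (phi (s + h) - phi s - h * phi' s) by ring.
rewrite normrM.
apply: (@le_trans _ _ ((`|c| + 1) * (e / (`|c| + 1) * h))).
  by rewrite ler_pM ?lerDl ?H.
by rewrite mulrA mulrCA divff ?mulr1// gt_eqF.
Qed.

Lemma unif_rderiv_sum (I : Type) (r : seq I) (F F' : I -> R -> R) :
  (forall i, unif_rderiv (F i) (F' i)) ->
  unif_rderiv (fun s => \sum_(i <- r) F i s) (fun s => \sum_(i <- r) F' i s).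
Proof.
move=> H; elim: r => [|i r IH].
  have -> : (fun s : R => \sum_(i <- [::]) F i s) = fun=> 0.
    by apply/funext => s; rewrite big_nil.
  have -> : (fun s : R => \sum_(i <- [::]) F' i s) = fun=> 0.
    by apply/funext => s; rewrite big_nil.
  exact: unif_rderiv0.
have -> : (fun s => \sum_(j <- i :: r) F j s) =
   fun s => F i s + \sum_(j <- r) F j s by apply/funext => s; rewrite big_cons.
have -> : (fun s => \sum_(j <- i :: r) F' j s) =
   fun s => F' i s + \sum_(j <- r) F' j s by apply/funext => s; rewrite big_cons.
exact: unif_rderivD.
Qed.

(** An integration of the bound on [phi'] without integrals: [[0, t]] is cut into equal steps, the
    bound is propagated from one grid point to the next with an error proportional to the length
    covered, and the total error [e] is arbitrary. *)
Lemma unif_rderiv_pow_bound phi phi' (C : R) m :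
  unif_rderiv phi phi' -> phi 0 = 0 ->
  (forall s, 0 <= s -> `|phi' s| <= C * s ^+ m) ->
  forall t, 0 <= t -> `|phi t| <= C * t ^+ m.+1 / m.+1%:R.
Proof.
move=> H p0 HC t; rewrite le_eqVlt => /predU1P[<-|t0].
  by rewrite p0 normr0 expr0n/= mulr0 mul0r.
have C0 : 0 <= C.
  by have := HC 1 ler01; rewrite expr1n mulr1; exact: le_trans.
(* The tangent of the convex function [a ^+ m.+1] lies below it; this compares one step of the
   Riemann sum of [s ^+ m] with its integral. *)
have bern (a h : R) : 0 <= a -> 0 <= h ->
    a ^+ m.+1 + m.+1%:R * h * a ^+ m <= (a + h) ^+ m.+1.
  move=> a0 h0; elim: m {HC} => [|k IH]; first by rewrite !expr1 expr0 mulr1 mul1r.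
  rewrite [leRHS]exprS; apply: le_trans (ler_wpM2l (addr_ge0 a0 h0) IH).
  rewrite -subr_ge0.
  have -> : (a + h) * (a ^+ k.+1 + k.+1%:R * h * a ^+ k) -
      (a ^+ k.+2 + k.+2%:R * h * a ^+ k.+1) = k.+1%:R * h ^+ 2 * a ^+ k.
    by rewrite -[k.+2%:R]natr1 !exprS; ring.
  by rewrite !mulr_ge0 ?exprn_ge0.
apply/ler_addgt0Pr => e e0.
have [d d0 {}H] := H _ (divr_gt0 e0 t0).
(* [M] is the number of steps, chosen to make each one shorter than [d]. *)
have [M /andP[M0 HM]] : exists M : nat, (0 < M)%N && (t / M%:R < d).
  exists (Num.truncn (t / d)).+1; rewrite /= ltr_pdivrMr ?ltr0n//.
  rewrite mulrC -ltr_pdivrMr//; exact: truncnS_gt.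
have M0' : (0 : R) < M%:R by rewrite ltr0n.
set h := t / M%:R; have h0 : 0 < h by rewrite divr_gt0.
(* The error per unit length is [e / t], which adds up to [e] at time [t]. *)
have K i : `|phi (i%:R * h)| <= C * (i%:R * h) ^+ m.+1 / m.+1%:R + e / t * (i%:R * h).
  elim: i => [|i IH]; first by rewrite mul0r p0 normr0 expr0n/= !mulr0 mul0r add0r.
  have s0 : 0 <= i%:R * h by rewrite mulr_ge0// ltW.
  have {H} := H h (i%:R * h); rewrite h0 HM => /(_ isT s0) H.
  have sE : i.+1%:R * h = i%:R * h + h by rewrite -natr1 mulrDl mul1r.
  rewrite {}sE.
  set s := i%:R * h in IH s0 H *.
  have -> : phi (s + h) = (phi (s + h) - phi s - h * phi' s) + (phi s + h * phi' s) by ring.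
  apply: le_trans (ler_normD _ _) _.
  apply: le_trans (lerD H (ler_normD _ _)) _.
  rewrite normrM (gtr0_norm h0).
  apply: le_trans (lerD (lexx _) (lerD IH (ler_wpM2l (ltW h0) (HC _ s0)))) _.
  have /(ler_wpM2l C0) := bern s h s0 (ltW h0).
  move=> B.
  have E : C * s ^+ m.+1 / m.+1%:R + h * (C * s ^+ m) <= C * (s + h) ^+ m.+1 / m.+1%:R.
    rewrite ler_pdivlMr ?ltr0n// mulrDl divfK ?pnatr_eq0//.
    by apply: le_trans B; rewrite le_eqVlt; apply/orP; left; apply/eqP; ring.
  rewrite (mulrDr (e / t)).
  move: E; set u := C * s ^+ m.+1 / _; set v := h * _; set z := C * _ / _.
  set e1 := e / t * h; set e2 := e / t * s; lra.
have := K M; rewrite /h mulrC divfK ?gt_eqF//.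
by rewrite divfK ?gt_eqF.
Qed.

(** Integrating the bound on [phi (k + m)] down [m] times divides it by [m!]. For [k = 0] this
    cancels the factorial growth and leaves [D * (K * t) ^+ m], which tends to 0. *)
Lemma factorial_growth_eq0 (phi : nat -> R -> R) (D K : R) : 0 <= K ->
  (forall k, unif_rderiv (phi k) (phi k.+1)) -> (forall k, phi k 0 = 0) ->
  (forall k s, 0 <= s -> `|phi k s| <= D * K ^+ k * k`!%:R) ->
  forall t, 0 <= t -> K * t < 1 -> phi 0 t = 0.
Proof.
move=> K0 Hd H0 Hb t t0 Kt.
have bnd m k s : 0 <= s ->
    `|phi k s| <= D * K ^+ (k + m) * (k + m)`!%:R / m`!%:R * s ^+ m.
  elim: m k s => [|m IH] k s s0; first by rewrite addn0 fact0 divr1 expr0 mulr1 Hb.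
  have := unif_rderiv_pow_bound (Hd k) (H0 k) (IH k.+1) s0.
  move/le_trans; apply; rewrite addSnnS factS natrM le_eqVlt; apply/orP; left; apply/eqP.
  by field; rewrite addrC natr1 !pnatr_eq0 -lt0n fact_gt0.
have bnd0 m : `|phi 0 t| <= D * (K * t) ^+ m.
  apply: le_trans (bnd m 0 t t0) _; rewrite add0n exprMn.
  by rewrite mulfK ?mulrA// pnatr_eq0 -lt0n fact_gt0.
apply/eqP; rewrite -normr_le0.
have Kt0 : 0 <= K * t by rewrite mulr_ge0.
have c : (fun m => D * (K * t) ^+ m) @ \oo --> (0 : R).
  rewrite -[X in _ --> X](mulr0 D); apply: cvgMr.
  by apply: cvg_expr; rewrite ger0_norm.
rewrite -(cvg_lim (@Rhausdorff R) c); apply: limr_ge; first by apply/cvg_ex; exists 0.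
by near=> m; exact: bnd0.
Unshelve. all: by end_near.
Qed.

End UniformRightDerivative.

(** * Cylinder functions and the generator *)

Section Cylinders.
Variables (R : realType) (n : nat).
Implicit Types (W : seq int) (f : config n -> R) (eta : config n).

Definition depends_on W f := forall eta zeta : config n,
  (forall k, k \in W -> eta k = zeta k) -> f eta = f zeta.

Definition cyl W (xi : config n) : set (config n) :=
  [set eta | forall k, k \in W -> eta k = xi k].

(** The value [ord0] outside of [W] is a placeholder that functions depending on [W] only cannot
    see. *)
Definition ext W (xi : {ffun seq_sub W -> 'I_n.+1}) : config n :=
  fun k => if insub k is Some i then xi i else ord0.

Definition restrict W eta : {ffun seq_sub W -> 'I_n.+1} :=
  [ffun i => eta (val i)].

Lemma ext_val W (xi : {ffun seq_sub W -> 'I_n.+1}) i : ext xi (val i) = xi i.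
Proof. by rewrite /ext valK. Qed.

Lemma ext_restrict W eta k : k \in W -> ext (restrict W eta) k = eta k.
Proof. by move=> kW; rewrite /ext insubT/= ffunE. Qed.

Lemma restrict_ext W (xi : {ffun seq_sub W -> 'I_n.+1}) : restrict W (ext xi) = xi.
Proof. by apply/ffunP => i; rewrite ffunE ext_val. Qed.

Lemma cyl_ext W (xi : {ffun seq_sub W -> 'I_n.+1}) eta :
  cyl W (ext xi) eta <-> xi = restrict W eta.
Proof.
split=> [H|-> k kW]; last by rewrite ext_restrict.
by apply/ffunP => i; rewrite ffunE -ext_val H//; exact: (valP i).
Qed.

Lemma measurable_coord k a : measurable ([set eta | eta k = a] : set (config n)).
Proof. by apply: (@sub_sigma_algebra _ _ (@coord_sets n)); exists k, a. Qed.

Lemma measurable_cyl W (xi : config n) : measurable (cyl W xi).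
Proof.
elim: W => [|k W IH].
  have -> : cyl [::] xi = setT by apply/seteqP; split.
  exact: measurableT.
have -> : cyl (k :: W) xi = [set eta | eta k = xi k] `&` cyl W xi.
  apply/seteqP; split=> [eta H|eta [/= H1 H2] j].
    split=> [|j jW] /=; apply: H; first exact: mem_head.
    by rewrite inE jW orbT.
  by rewrite inE => /predU1P[->//|]; exact: H2.
by apply: measurableI => //; exact: measurable_coord.
Qed.

Lemma depends_on_cyl W xi : depends_on W (\1_(cyl W xi) : config n -> R).
Proof.
move=> eta zeta H; rewrite !indicE; congr (_ : bool)%:R.
by apply/idP/idP; rewrite !inE => K k kW; rewrite -(K k kW) H.
Qed.

(** Exactly one cylinder with base [W] contains [eta], that of [restrict W eta]. *)
Lemma cyl_decomp W f eta : depends_on W f ->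
  f eta = \sum_(xi : {ffun seq_sub W -> 'I_n.+1})
    f (ext xi) * \1_(cyl W (ext xi)) eta.
Proof.
move=> fW; rewrite (bigD1 (restrict W eta))//= big1 => [|xi xine].
  rewrite addr0 indicE mem_set ?mulr1; first by apply: fW => k kW; rewrite ext_restrict.
  exact/cyl_ext.
rewrite indicE memNset ?mulr0// => /cyl_ext E.
by rewrite E eqxx in xine.
Qed.

Section Integral.
Variables (mu : {measure set (config n) -> \bar R}) (mu1 : mu setT = 1%E).

Lemma mu_cyl_fin W xi : mu (cyl W xi) \is a fin_num.
Proof.
rewrite ge0_fin_numE// (le_lt_trans _ (ltry 1))// -mu1.
by apply: le_measure => //; rewrite inE//; exact: measurable_cyl.
Qed.

Lemma integrable_cyl W xi :
  mu.-integrable setT (EFin \o (\1_(cyl W xi) : config n -> R)).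
Proof.
apply/integrableP; split.
  by apply/measurable_EFinP; apply: measurable_indic; exact: measurable_cyl.
under eq_integral do rewrite /= ger0_norm//.
rewrite integral_indic ?setIT//; last exact: measurable_cyl.
by rewrite ltey_eq mu_cyl_fin.
Qed.

(** Integrals of cylinder functions become finite sums over patterns, which settles measurability
    and integrability at the same time. *)
Lemma integral_depends_on W f : depends_on W f ->
  (\int[mu]_eta (f eta)%:E)%E =
  (\sum_(xi : {ffun seq_sub W -> 'I_n.+1})
    f (ext xi) * fine (mu (cyl W (ext xi))))%:E.
Proof.
move=> fW.
transitivity (\int[mu]_eta (\sum_(xi : {ffun seq_sub W -> 'I_n.+1})
    (f (ext xi))%:E * (\1_(cyl W (ext xi)) eta)%:E))%E.
  by apply: eq_integral => eta _; rewrite (cyl_decomp eta fW) sumEFin.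
rewrite integral_sum//; last by move=> xi; apply: integrableZl => //; exact: integrable_cyl.
rewrite -sumEFin; apply: eq_bigr => xi _.
rewrite integralZl//; last exact: integrable_cyl.
rewrite integral_indic ?setIT//; last exact: measurable_cyl.
by rewrite EFinM fineK// mu_cyl_fin.
Qed.

Lemma Rintegral_depends_on W f : depends_on W f ->
  \int[mu]_eta f eta = \sum_(xi : {ffun seq_sub W -> 'I_n.+1})
    f (ext xi) * fine (mu (cyl W (ext xi))).
Proof. by move=> fW; rewrite /Rintegral (integral_depends_on fW). Qed.

Lemma sum_cyl W :
  \sum_(xi : {ffun seq_sub W -> 'I_n.+1}) fine (mu (cyl W (ext xi))) = 1.
Proof.
have H : depends_on W (cst 1 : config n -> R) by [].
have := Rintegral_depends_on H; rewrite Rintegral_cst// mu1 mul1r/= => ->.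
by apply: eq_bigr => xi _; rewrite mul1r.
Qed.

Lemma norm_Rintegral_depends_on W f B : depends_on W f ->
  (forall eta, `|f eta| <= B) -> `|\int[mu]_eta f eta| <= B.
Proof.
move=> fW fB; rewrite (Rintegral_depends_on fW).
apply: le_trans (ler_norm_sum _ _ _) _.
rewrite -[B]mulr1 -(sum_cyl W) mulr_sumr; apply: ler_sum => xi _.
rewrite normrM (ger0_norm (fine_ge0 _))//.
by rewrite ler_wpM2r ?fine_ge0.
Qed.

Lemma Rintegral_cyl W xi : \int[mu]_eta \1_(cyl W xi) eta = fine (mu (cyl W xi)).
Proof. by rewrite /Rintegral integral_indic ?setIT//; exact: measurable_cyl. Qed.

End Integral.
End Cylinders.

(** * Boxes of sites and their bonds *)

Section Intervals.

Definition intv (a : int) (l : nat) : seq int := [seq a + i%:Z | i <- iota 0 l].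

Lemma mem_intv a l k : (k \in intv a l) = (a <= k < a + l%:Z).
Proof.
apply/mapP/idP => [[i]|/andP[ak kl]].
  by rewrite mem_iota => /andP[_ il] ->; lia.
by exists `|k - a|%N; [rewrite mem_iota; lia|lia].
Qed.

Lemma intv_uniq a l : uniq (intv a l).
Proof. by rewrite map_inj_uniq ?iota_uniq// => i j /addrI []. Qed.

Definition window (r : nat) := intv (- r%:Z) (2 * r + 1).

Lemma mem_window r k : (k \in window r) = (`|k| <= r)%N.
Proof. by rewrite mem_intv; apply/idP/idP; lia. Qed.

(** A bond is named by its left end; these are the bonds with both ends in the window. *)
Definition window_bonds (r : nat) := intv (- r%:Z) (2 * r).

Lemma mem_window_bonds r k :
  (k \in window_bonds r) = (k \in window r) && (k + 1 \in window r).
Proof. by rewrite !mem_window mem_intv; apply/idP/idP; lia. Qed.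

End Intervals.

(** * Locality of the generator and growth of its iterates *)

Section Generator.
Variables (R : realType) (n : nat) (w q : R).
Implicit Types (W : seq int) (f : config n -> R) (eta : config n).

Definition asep_rate (a b : 'I_n.+1) : R :=
  w * (q ^ sgz ((a : nat)%:Z - (b : nat)%:Z) - (a == b)%:R).

Lemma depends_on_sub W W' f : {subset W <= W'} -> depends_on W f -> depends_on W' f.
Proof. by move=> WW' fW eta zeta H; apply: fW => k /WW'; exact: H. Qed.

Lemma depends_on_exchange W f eta k : depends_on W f ->
  k \notin W -> k + 1 \notin W -> f (exchange k eta) = f eta.
Proof.
move=> fW kW k1W; apply: fW => j jW; rewrite /exchange.
have [jk|_] := eqVneq j k; first by rewrite -jk jW in kW.
have [jk|_] := eqVneq j (k + 1); first by rewrite -jk jW in k1W.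
by [].
Qed.

Lemma asep_gen_sum W (S : seq int) f eta : depends_on W f -> uniq S ->
  (forall k, k \notin S -> (k \notin W) && (k + 1 \notin W)) ->
  asep_gen w q f eta = \sum_(k <- S)
    asep_rate (eta k) (eta (k + 1)) * (f (exchange k eta) - f eta).
Proof.
move=> fW uS HS; rewrite /asep_gen [RHS]fsbig_seq//.
apply/esym/fsbig_widen => // k [_ /= kS].
have /andP[k0 k1] := HS k (introN idP kS).
by rewrite (depends_on_exchange _ fW)// subrr mulr0.
Qed.

(** The bonds that touch the window have their left ends between [-(r + 1)] and [r], which makes
    [2 * r.+1] of them. *)
Lemma asep_gen_window r f eta : depends_on (window r) f ->
  asep_gen w q f eta = \sum_(k <- intv (- r.+1%:Z) (2 * r.+1))
    asep_rate (eta k) (eta (k + 1)) * (f (exchange k eta) - f eta).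
Proof.
move=> fr; apply: (asep_gen_sum _ fr); first exact: intv_uniq.
by move=> k; rewrite mem_intv !mem_window => kS; apply/andP; split; lia.
Qed.

Lemma depends_on_asep_gen r f :
  depends_on (window r) f -> depends_on (window r.+1) (asep_gen w q f).
Proof.
move=> fr eta zeta H; rewrite !(asep_gen_window _ fr).
apply: eq_big_seq => k; rewrite mem_intv => kS.
rewrite !H; [|by rewrite mem_window; lia..].
congr (_ * (_ - _)); apply: fr => j; rewrite mem_window => jr; last first.
  by apply: H; rewrite mem_window; lia.
by rewrite /exchange; case: eqP => [|_]; [|case: eqP => [|_]] => *;
  apply: H; rewrite mem_window; lia.
Qed.

Lemma iter_asep_gen_depends_on r f k : depends_on (window r) f ->
  depends_on (window (r + k)) (iter k (asep_gen w q) f).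
Proof.
move=> fr; elim: k => [|k IH]; first by rewrite addn0.
by rewrite addnS; exact: depends_on_asep_gen.
Qed.

Hypotheses (w0 : 0 < w) (q1 : 1 < q).

Lemma asep_rate_bound a b : `|asep_rate a b| <= w * q.
Proof.
have q0 : 0 < q by rewrite (lt_trans ltr01).
rewrite /asep_rate normrM (gtr0_norm w0) ler_pM2l//.
have [->|ab] := eqVneq a b; first by rewrite subrr sgz0 expr0z subrr normr0 ltW.
rewrite subr0 gtr0_norm ?exprz_gt0//.
have [||/eqP] := ltgtP (b : nat) (a : nat).
- by move=> ba; rewrite gtr0_sgz ?subr_gt0 ?ltz_nat.
- move=> ab'; rewrite ltr0_sgz ?subr_lt0 ?ltz_nat// exprN1.
  by rewrite (le_trans _ (ltW q1))// invf_le1// ltW.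
- by rewrite eq_sym (inj_eq val_inj) (negbTE ab).
Qed.

(** There are [2 * r.+1] active bonds, each with a rate at most [w * q] and an increment of [f] at
    most [2 * B]. *)
Lemma asep_gen_bound r f B : depends_on (window r) f ->
  (forall eta, `|f eta| <= B) ->
  forall eta, `|asep_gen w q f eta| <= 4 * w * q * r.+1%:R * B.
Proof.
move=> fr fB eta; rewrite (asep_gen_window _ fr).
have B0 : 0 <= B by exact: le_trans (fB eta).
apply: le_trans (ler_norm_sum _ _ _) _.
apply: (@le_trans _ _ (\sum_(k <- intv (- r.+1%:Z) (2 * r.+1)) w * q * (2 * B))).
  apply: ler_sum => k _; rewrite normrM ler_pM ?asep_rate_bound//.
  rewrite (le_trans (ler_normB _ _))//.
  by rewrite mulr2n mulrDl mul1r lerD.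
rewrite big_const_seq count_predT size_map size_iota iter_addr addr0.
rewrite -(mulr_natr (_ * (2 * B))) natrM le_eqVlt; apply/orP; left; apply/eqP; ring.
Qed.

(** The [k] successive windows contribute the falling factorial of [r + k], that is [k!] times a
    binomial coefficient at most [2 ^ (r + k)]. The part [2 ^ k] turns the constant 4 into 8 and
    [2 ^ r] stays in front. *)
Lemma iter_asep_gen_bound r f B k : depends_on (window r) f ->
  (forall eta, `|f eta| <= B) ->
  forall eta, `|iter k (asep_gen w q) f eta| <= 2 ^+ r * B * (8 * w * q) ^+ k * k`!%:R.
Proof.
move=> fr fB eta.
have q0 : 0 < q by rewrite (lt_trans ltr01).
have B0 : 0 <= B by exact: le_trans (fB eta).
have b : `|iter k (asep_gen w q) f eta| <= (4 * w * q) ^+ k * ((r + k) ^_ k)%:R * B.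
  elim: k eta => [|k IH] eta; first by rewrite ffactn0 expr0 !mul1r; exact: fB.
  have /(_ _ IH eta) H := asep_gen_bound (@iter_asep_gen_depends_on _ _ k fr).
  rewrite iterS; apply: le_trans H _.
  rewrite addnS ffactSS natrM le_eqVlt; apply/orP; left; apply/eqP.
  by rewrite exprS; ring.
apply: le_trans b _.
have -> : 2 ^+ r * B * (8 * w * q) ^+ k * k`!%:R =
    (4 * w * q) ^+ k * (2 ^+ (r + k) * k`!%:R) * B.
  have -> : 8 * w * q = 2 * (4 * w * q) by ring.
  by rewrite exprMn exprD; ring.
rewrite ler_wpM2r// ler_wpM2l//; first by rewrite exprn_ge0// !mulr_ge0 ?ltW.
rewrite -bin_ffact natrM ler_wpM2r// -natrX ler_nat.
(* The binomial coefficient is one term of the expansion of [(1 + 1) ^ (r + k)]. *)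
rewrite -[(2 ^ _)%N]/((1 + 1) ^ (r + k))%N Pascal.
rewrite (bigD1 (inord k : 'I_(r + k).+1))//= inordK; last by rewrite ltnS leq_addl.
by rewrite !exp1n !muln1 leq_addr.
Qed.

End Generator.

(** * The law of the exclusion process *)

Section Law.
Variables (R : realType) (n : nat).
Variable (P : R -> R.-pker (config n) ~> (config n)).
Variable nu : probability (config n) R.
Implicit Types (W : seq int) (f : config n -> R) (eta : config n) (s t h : R).

(** The measure [law_at] obtained as a composition of kernels, with [nu] seen as a kernel from a
    one-point space; this provides the measure structure and the iterated integral formula. *)
Definition law t : {measure set (config n) -> \bar R} :=
  mkcomp (kprobability (measurable_cst (nu : pprobability (config n) R)
                        : measurable_fun [set: unit] _))
    (kernel.kernel_snd (P t)) tt.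

Lemma lawE t A : law t A = law_at P nu t A.
Proof. by []. Qed.

Lemma integral_law t (g : config n -> \bar R) :
  (forall eta, 0 <= g eta)%E -> measurable_fun setT g ->
  (\int[law t]_z g z = \int[nu]_eta \int[P t eta]_z g z)%E.
Proof. by move=> g0 mg; rewrite integral_kcomp. Qed.

Lemma law_setT t : law t setT = 1%E.
Proof.
rewrite lawE /law_at.
under eq_integral do rewrite prob_kernel.
rewrite integral_cst//= mul1e. exact: probability_setT.
Qed.


Lemma law_add (hP : feller_process P) s h A : 0 <= s -> 0 <= h -> measurable A ->
  (law (s + h) A = \int[law s]_z P h z A)%E.
Proof.
move=> s0 h0 mA; rewrite integral_law//; last exact: measurable_kernel.
by rewrite lawE; apply: eq_integral => eta _; exact: feller_chapman_kolmogorov.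
Qed.

Lemma integrable_kernel s h A : measurable A ->
  (law s).-integrable setT (fun z => P h z A).
Proof.
move=> mA; apply/integrableP; split; first exact: measurable_kernel.
apply: (@le_lt_trans _ _ (\int[law s]_z (cst 1 z))%E); last first.
  by rewrite integral_cst// mul1e law_setT ltry.
apply: ge0_le_integral => //.
- by apply: measurableT_comp => //; exact: measurable_kernel.
- by move=> z _; rewrite gee0_abs// -(@prob_kernel _ _ _ _ _ (P h) z) le_measure ?inE.
Qed.

Lemma kernel_fin_num h z A : measurable A -> P h z A \is a fin_num.
Proof.
move=> mA; rewrite ge0_fin_numE// (le_lt_trans _ (ltry 1))//.
by rewrite -(@prob_kernel _ _ _ _ _ (P h) z) le_measure ?inE.
Qed.

Lemma kernel_opE W f h eta : depends_on W f ->
  kernel_op P h f eta = \sum_(xi : {ffun seq_sub W -> 'I_n.+1})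
    f (ext xi) * fine (P h eta (cyl W (ext xi))).
Proof. by move=> fW; apply: Rintegral_depends_on => //; exact: prob_kernel. Qed.

(** Chapman-Kolmogorov is given on sets; the finite decomposition of [f] into cylinders carries it
    over to functions. *)
Lemma Rintegral_law_add (hP : feller_process P) W f s h : 0 <= s -> 0 <= h ->
  depends_on W f ->
  (\int[law (s + h)]_z (f z)%:E = \int[law s]_z (kernel_op P h f z)%:E)%E.
Proof.
move=> s0 h0 fW; rewrite (integral_depends_on (law_setT _) fW).
transitivity (\int[law s]_z (\sum_(xi : {ffun seq_sub W -> 'I_n.+1})
    (f (ext xi))%:E * P h z (cyl W (ext xi))))%E; last first.
  apply: eq_integral => z _; rewrite (kernel_opE _ _ fW) -sumEFin.
  by apply: eq_bigr => xi _; rewrite EFinM fineK// kernel_fin_num//; exact: measurable_cyl.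
rewrite integral_sum//; last first.
  by move=> xi; apply: integrableZl => //; apply: integrable_kernel; exact: measurable_cyl.
rewrite -sumEFin; apply: eq_bigr => xi _.
rewrite integralZl//; last by apply: integrable_kernel; exact: measurable_cyl.
rewrite -law_add//; last exact: measurable_cyl.
by rewrite EFinM fineK// mu_cyl_fin// law_setT.
Qed.

Lemma integrable_depends_on (mu : {measure set (config n) -> \bar R}) W f :
  mu setT = 1%E -> depends_on W f -> mu.-integrable setT (EFin \o f).
Proof.
move=> mu1 fW.
rewrite (_ : EFin \o f = fun z => (\sum_(xi : {ffun seq_sub W -> 'I_n.+1})
    (f (ext xi))%:E * (\1_(cyl W (ext xi)) z)%:E)%E); last first.
  by apply/funext => eta /=; rewrite (cyl_decomp eta fW) sumEFin.
apply: integrable_sum => // xi _; apply: integrableZl => //.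
exact: integrable_cyl.
Qed.

Lemma integrable_kernel_op W f s h : depends_on W f ->
  (law s).-integrable setT (EFin \o kernel_op P h f).
Proof.
move=> fW.
rewrite (_ : EFin \o _ = fun z => (\sum_(xi : {ffun seq_sub W -> 'I_n.+1})
    (f (ext xi))%:E * P h z (cyl W (ext xi)))%E); last first.
  apply/funext => z /=; rewrite (kernel_opE _ _ fW) -sumEFin.
  by apply: eq_bigr => xi _; rewrite EFinM fineK// kernel_fin_num//; exact: measurable_cyl.
apply: integrable_sum => // xi _; apply: integrableZl => //.
by apply: integrable_kernel; exact: measurable_cyl.
Qed.

Lemma norm_Rintegral_le (mu : {measure set (config n) -> \bar R}) (g : config n -> R) B :
  mu setT = 1%E -> mu.-integrable setT (EFin \o g) ->
  (forall z, `|g z| <= B) -> `|\int[mu]_z g z| <= B.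
Proof.
move=> mu1 ig gB.
apply: le_trans (le_normr_Rintegral _ ig) _ => //.
have -> : B = \int[mu]_z (cst B z) by rewrite Rintegral_cst// mu1 mulr1.
apply: le_Rintegral => //.
- by have := integrable_norm ig.
- by apply: (@integrable_depends_on mu [::]).
Qed.

Variables (w q : R).

(** The epsilon-delta form of the convergence in the topology of uniform convergence. *)
Lemma asep_uniform_derivative f : priority_asep w q P -> cylinder f ->
  forall e, 0 < e -> exists2 d, 0 < d & forall h, 0 < h < d -> forall eta,
    `|(kernel_op P h f eta - f eta) / h - asep_gen w q f eta| < e.
Proof.
move=> [_ H] /H {}H e e0.
have : \forall t \near 0^'+, forall eta,
    `|(kernel_op P t f eta - f eta) / t - asep_gen w q f eta| < e.
  apply: (H [set g | forall eta, `|g eta - asep_gen w q f eta| < e]).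
  apply/uniform_nbhs; exists [set xy | ball xy.1 e xy.2]; split.
    exact: (entourage_ball _ (PosNum e0)).
  by move=> g /= gE eta; have := gE eta I; rewrite /ball/= distrC.
move=> /nbhs_ballP[d /= d0 Hd]; exists d => // h /andP[h0 hd].
by apply: Hd => //=; rewrite /ball/= sub0r normrN gtr0_norm.
Qed.

(** The forward equation. The generator approximates the difference quotient uniformly in the
    configuration, so the error survives integration against the probability [law s], whatever [s]
    is. *)
Lemma law_rderiv r f : priority_asep w q P -> depends_on (window r) f ->
  unif_rderiv (fun s => \int[law s]_z f z) (fun s => \int[law s]_z asep_gen w q f z).
Proof.
move=> hP fr e e0.
have fcyl : cylinder f by exists (window r).
have [d d0 Hd] := asep_uniform_derivative hP fcyl e0.
exists d => // h s hd s0; have /andP[h0 _] := hd.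
have LW := @depends_on_asep_gen _ _ w q _ _ fr.
have -> : \int[law (s + h)]_z f z = \int[law s]_z kernel_op P h f z.
  by rewrite /Rintegral (Rintegral_law_add hP.1 s0 (ltW h0) fr).
have i1 := integrable_kernel_op s h fr.
have i2 := integrable_depends_on (law_setT s) fr.
have i3 := integrable_depends_on (law_setT s) LW.
have i4 : (law s).-integrable setT (EFin \o (fun z => h * asep_gen w q f z)).
  exact: (integrableZl _ _ i3).
have i5 : (law s).-integrable setT (EFin \o (fun z => kernel_op P h f z - f z)).
  exact: (integrableB _ i1 i2).
rewrite -RintegralB// -RintegralZl// -RintegralB//.
apply: norm_Rintegral_le; first exact: law_setT.
  exact: (integrableB _ i5 i4).
move=> z; have := Hd h hd z.
have -> : kernel_op P h f z - f z - h * asep_gen w q f z =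
  ((kernel_op P h f z - f z) / h - asep_gen w q f z) * h.
  by rewrite mulrBl divfK ?gt_eqF// (mulrC h).
by move=> H; rewrite normrM (gtr0_norm h0) ler_wpM2r// ltW.
Qed.

Lemma law0 A : feller_process P -> measurable A -> law 0 A = nu A.
Proof.
move=> hP mA; rewrite lawE /law_at.
under eq_integral do rewrite feller_init//.
by rewrite integral_indic// setIT.
Qed.

End Law.

(** * The backward equation of a chain with finitely many targets *)

Section EsumSplit.
Variables (R : realType) (T : choiceType).
Local Open Scope ereal_scope.

Lemma esumMr (a : T -> \bar R) (c : R) : (forall x, 0 <= a x) -> (0 <= c)%R ->
  \esum_(x in setT) (a x * c%:E) = (\esum_(x in setT) a x) * c%:E.
Proof.
move=> a0; rewrite le_eqVlt => /predU1P[<-|c0].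
  by rewrite mule0 esum1// => x _; rewrite mule0.
have le (b : T -> \bar R) (d : R) : (forall x, 0 <= b x) -> (0 < d)%R ->
    \esum_(x in setT) (b x * d%:E) <= (\esum_(x in setT) b x) * d%:E.
  move=> b0 d0; apply: ge_ereal_sup => _ [X [fX _] <-].
  rewrite fsbig_finite//= -ge0_sume_distrl//.
  rewrite lee_pmul2r//; apply: esum_ge; exists X => //.
  by rewrite fsbig_finite.
apply/eqP; rewrite eq_le le//=.
(* The reverse inequality is the same one for the family [a x * c] and the factor [c^-1]. *)
have := le (fun x => a x * c%:E) (c^-1)%R.
have -> : (fun x => a x * c%:E * c^-1%:E) = a.
  by apply/funext => x; rewrite -muleA -EFinM divff ?gt_eqF// mule1.
move=> /(_ _ _)/(lee_wpmul2r (_ : 0 <= c%:E)) H.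
have c0' : 0 <= c%:E by rewrite lee_fin ltW.
have := H c0' (fun x => mule_ge0 (a0 x) c0').
rewrite invr_gt0 => /(_ c0).
by rewrite -muleA -EFinM mulVf ?gt_eqF// mule1.
Qed.

Lemma esum_swap (T' : choiceType) (a : T -> T' -> \bar R) :
  (forall x y, 0 <= a x y) ->
  \esum_(x in setT) \esum_(y in setT) a x y =
  \esum_(y in setT) \esum_(x in setT) a x y.
Proof.
move=> a0; rewrite !esum_esum//.
rewrite (reindex_esum (setT `*`` (fun=> setT)) _ (fun x : T' * T => (x.2, x.1)))//.
split=> //=; first by move=> [x y] [y' x'] _ _ [-> ->].
by move=> [x y] _; exists (y, x).
Qed.

Lemma esum_seq_split (s : seq T) (a : T -> \bar R) : uniq s ->
  (forall x, 0 <= a x) ->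
  \esum_(x in setT) a x =
  \sum_(x <- s) a x + \esum_(x in ~` [set` s]) a x.
Proof.
move=> us a0; rewrite (esumID [set` s] setT)//= !setTI; congr (_ + _).
rewrite esum_fset//.
by rewrite -fsbig_seq.
Qed.

End EsumSplit.

(** * Chains whose transitions carry labels in a finite type *)

Section Chain.
Variables (R : realType) (T : choiceType) (I : finType).
Variables (tgt : T -> I -> T) (rt : T -> I -> R) (r : T -> T -> R).
Hypothesis r_targets : forall x y, y != x ->
  r x y = \sum_i rt x i * (y == tgt x i)%:R.

(** The generator as a sum over labels. A label whose target is [x] itself contributes 0, so
    spurious loops are harmless. *)
Definition chain_gen (u : T -> R) (x : T) : R :=
  \sum_i rt x i * (u (tgt x i) - u x).

Lemma chain_gen_bound (c B : R) (u : T -> R) :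
  (forall x i, 0 <= rt x i) -> (forall x, \sum_i rt x i <= c) ->
  (forall x, `|u x| <= B) -> forall x, `|chain_gen u x| <= 2 * c * B.
Proof.
move=> rt0 rtc uB x; apply: le_trans (ler_norm_sum _ _ _) _.
have B0 : 0 <= B by exact: le_trans (uB x).
apply: (@le_trans _ _ (\sum_i rt x i * (2 * B))).
  apply: ler_sum => i _; rewrite normrM ger0_norm// ler_wpM2l//.
  by rewrite (le_trans (ler_normB _ _))// mulr2n mulrDl mul1r lerD.
by rewrite -mulr_suml mulrA [2 * c]mulrC !ler_wpM2r.
Qed.

Lemma iter_chain_gen_bound (c B : R) (u : T -> R) :
  (forall x i, 0 <= rt x i) -> (forall x, \sum_i rt x i <= c) ->
  (forall x, `|u x| <= B) ->
  forall k x, `|iter k chain_gen u x| <= (2 * c) ^+ k * B.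
Proof.
move=> rt0 rtc uB; elim=> [|k IH] x; first by rewrite mul1r uB.
by rewrite iterS exprS -mulrA; exact: chain_gen_bound.
Qed.

(** The row of [x] is supported by [s], and its diagonal entry is minus the sum of the other ones,
    which replaces [u z] by [u z - u x]. *)
Lemma q_matrix_targets (u : T -> R) x (s : seq T) : uniq s -> x \in s ->
  (forall i, tgt x i \in s) ->
  \sum_(z <- s) q_matrix r x z * u z = chain_gen u x.
Proof.
move=> us xs ts.
have r0 z : z != x -> z \notin s -> r x z = 0.
  move=> zx zs; rewrite r_targets// big1// => i _.
  by case: eqP => [E|]; [rewrite E ts in zs|rewrite mulr0].
have sr : \sum_(z \in [set~ x]) r x z = \sum_(z <- s | z != x) r x z.
  rewrite -[RHS]big_filter [RHS]fsbig_seq ?filter_uniq//; apply/esym/fsbig_widen.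
    by move=> z /=; rewrite mem_filter => /andP[/eqP].
  move=> z [/= /eqP zx]; rewrite mem_filter zx/= => /negP; exact: r0.
rewrite (bigD1_seq x)//= {1}/q_matrix eqxx sr.
transitivity (\sum_(z <- s | z != x) r x z * (u z - u x)).
  under [RHS]eq_bigr do rewrite mulrBr.
  rewrite sumrB mulNr addrC mulr_suml; congr (_ - _).
  by apply: eq_bigr => z zx; rewrite /q_matrix (negbTE zx).
transitivity (\sum_(z <- s) \sum_i rt x i * (z == tgt x i)%:R * (u z - u x)).
  rewrite [RHS](bigD1_seq x)//= [X in _ = X + _]big1 ?add0r; last first.
    by move=> i _; rewrite subrr mulr0.
  by apply: eq_bigr => z zx; rewrite r_targets// mulr_suml.
rewrite exchange_big/=; apply: eq_bigr => i _.
rewrite (bigD1_seq (tgt x i))//= eqxx mulr1 big1 ?addr0// => z /negbTE ->.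
by rewrite mulr0 mul0r.
Qed.

Variable p : R -> T -> T -> R.
Hypothesis hp : ctmc r p.

(** The semigroup of the chain applied to [g]; [fine] is harmless when [g] takes values in
    [[0, 1]]. *)
Definition transport (g : T -> R) (s : R) (x : T) : R :=
  fine (\esum_(y in setT) (p s x y * g y)%:E).

Section Transport.
Variable g : T -> R.
Hypothesis g01 : forall y, 0 <= g y <= 1.

Let g0 y : 0 <= g y. Proof. by have /andP[] := g01 y. Qed.

Lemma transport_term_ge0 s x y : 0 <= s -> (0 <= (p s x y * g y)%:E)%E.
Proof. by move=> s0; rewrite lee_fin mulr_ge0//; exact: ctmc_ge0 hp _ _ _ s0. Qed.

Lemma transport_le1 s x : 0 <= s -> (\esum_(y in setT) (p s x y * g y)%:E <= 1)%E.
Proof.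
move=> s0; rewrite -(ctmc_sum1 hp x s0); apply: le_esum => y _.
rewrite lee_fin ler_piMr//; first exact: ctmc_ge0 hp _ _ _ s0.
by have /andP[] := g01 y.
Qed.

Lemma transportE s x : 0 <= s ->
  (\esum_(y in setT) (p s x y * g y)%:E = (transport g s x)%:E)%E.
Proof.
move=> s0; rewrite fineK// ge0_fin_numE; last first.
  by apply: esum_ge0 => y _; exact: transport_term_ge0.
by rewrite (le_lt_trans (transport_le1 _ s0))// ltry.
Qed.

Lemma transport01 s x : 0 <= s -> 0 <= transport g s x <= 1.
Proof.
move=> s0; rewrite -!lee_fin -transportE// transport_le1// andbT.
by apply: esum_ge0 => y _; exact: transport_term_ge0.
Qed.

Lemma transport0 x : transport g 0 x = g x.
Proof.
rewrite /transport (esum_seq_split (s := [:: x]))//; last first.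
  by move=> y; exact: transport_term_ge0.
rewrite big_seq1 esum1 ?adde0 ?(ctmc_init hp) ?eqxx ?mul1r// => y /= /negP.
by rewrite inE (ctmc_init hp) => /negbTE ->; rewrite mul0r.
Qed.

(** The short time [h] comes first, as the backward equation requires: Chapman-Kolmogorov and an
    exchange of two nonnegative sums. *)
Lemma transport_add s h x : 0 <= s -> 0 <= h ->
  (\esum_(z in setT) (p h x z * transport g s z)%:E = (transport g (h + s) x)%:E)%E.
Proof.
move=> s0 h0; rewrite -transportE ?addr_ge0//.
transitivity (\esum_(z in setT) \esum_(y in setT) (p h x z * p s z y * g y)%:E)%E.
  apply: eq_esum => z _; rewrite mulrC EFinM -transportE// -esumMr; last 2 first.
  - by move=> y; exact: transport_term_ge0.
  - exact: ctmc_ge0 hp _ _ _ h0.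
  by apply: eq_esum => y _; rewrite -EFinM mulrC mulrA.
rewrite esum_swap; last first.
  by move=> z y; rewrite lee_fin !mulr_ge0//; apply: (ctmc_ge0 hp).
apply: eq_esum => y _; rewrite EFinM (ctmc_chapman_kolmogorov hp)// -esumMr//.
by move=> z; rewrite lee_fin mulr_ge0//; apply: (ctmc_ge0 hp).
Qed.

(* As [r x] has finite support and [p h x] has mass 1, the mass that [p h x]
   puts outside of the support is controlled by the error on the support. *)
Lemma transport_rderiv x :
  unif_rderiv (fun s => transport g s x) (fun s => chain_gen (transport g s) x).
Proof.
pose S := undup (x :: [seq tgt x i | i <- enum I]).
have uS : uniq S by exact: undup_uniq.
have xS : x \in S by rewrite mem_undup mem_head.
have tS i : tgt x i \in S by rewrite mem_undup inE map_f ?orbT ?mem_enum.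
(* The distance, summed over [S], between the row of [p h] and that of the identity plus [h] times
   the rate matrix. It is [o(h)] because [S] is finite. *)
pose err h := \sum_(z <- S) `|p h x z - (z == x)%:R - h * q_matrix r x z|.
(* One [err h] accounts for the terms in [S], the other one for the mass outside of [S]. *)
have err_bound h s : 0 <= h -> 0 <= s ->
    `|transport g (s + h) x - transport g s x - h * chain_gen (transport g s) x|
    <= 2 * err h.
  move=> h0 s0; set u := transport g s.
  have p0 z : 0 <= p h x z by exact: ctmc_ge0 hp _ _ _ h0.
  have u0 z : 0 <= u z by have /andP[] := transport01 z s0.
  have u1 z : u z <= 1 by have /andP[] := transport01 z s0.
  have E1 := ctmc_sum1 hp x h0.
  rewrite (esum_seq_split uS) in E1; last by move=> z; rewrite lee_fin.
  have E2 := transport_add x s0 h0.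
  rewrite (esum_seq_split uS) in E2; last by move=> z; rewrite lee_fin mulr_ge0.
  rewrite !sumEFin in E1 E2.
  set t1 := (\esum_(z in _) _)%E in E1; set t2 := (\esum_(z in _) _)%E in E2.
  have t2t1 : (t2 <= t1)%E.
    by apply: le_esum => z _; rewrite lee_fin ler_piMr.
  have t20 : (0 <= t2)%E by apply: esum_ge0 => z _; rewrite lee_fin mulr_ge0.
  have t1fin : t1 \is a fin_num.
    rewrite ge0_fin_numE; last exact: le_trans t2t1.
    apply: (@le_lt_trans _ _ 1%E); last by rewrite ltry.
    by rewrite -E1 leeDr// lee_fin sumr_ge0.
  have t2fin : t2 \is a fin_num.
    rewrite ge0_fin_numE//; apply: le_lt_trans t2t1 _.
    by rewrite ltey_eq t1fin.
  rewrite -(fineK t1fin) -(fineK t2fin) !lee_fin in t2t1 t20.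
  rewrite -(fineK t1fin) -EFinD in E1; rewrite -(fineK t2fin) -EFinD in E2.
  case: E1 => E1; case: E2 => E2.
  rewrite (addrC s) -E2 -(q_matrix_targets u uS xS tS).
  have Su (v : T -> R) : \sum_(z <- S) (z == x)%:R * v z = v x.
    rewrite (bigD1_seq x)//= eqxx mul1r big1 ?addr0// => z /negbTE ->.
    by rewrite mul0r.
  have Sdiff (v : T -> R) :
      \sum_(z <- S) (p h x z - (z == x)%:R - h * q_matrix r x z) * v z =
      \sum_(z <- S) p h x z * v z - v x - h * \sum_(z <- S) q_matrix r x z * v z.
    rewrite -(Su v) mulr_sumr -!sumrB; apply: eq_bigr => z _; ring.
  have q0 : \sum_(z <- S) q_matrix r x z = 0.
    have := q_matrix_targets (fun=> 1) uS xS tS.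
    under eq_bigr do rewrite mulr1.
    by move=> ->; rewrite /chain_gen big1// => i _; rewrite subrr mulr0.
  (* The row of the rate matrix sums to 0 over [S], so the mass that leaves [S] is minus the sum of
     the errors in [S]. *)
  have T1 : fine t1 = - \sum_(z <- S) (p h x z - (z == x)%:R - h * q_matrix r x z) * 1.
    rewrite (Sdiff (fun=> 1)).
    under eq_bigr do rewrite mulr1.
    under [X in _ - h * X]eq_bigr do rewrite mulr1.
    by rewrite q0 mulr0 subr0 -E1; ring.
  have T1e : fine t1 <= err h.
    rewrite T1 (le_trans (ler_norm _))// normrN (le_trans (ler_norm_sum _ _ _))//.
    by apply: ler_sum => z _; rewrite mulr1.
  have -> : \sum_(z <- S) p h x z * u z + fine t2 - u x
      - h * \sum_(z <- S) q_matrix r x z * u z =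
    \sum_(z <- S) (p h x z - (z == x)%:R - h * q_matrix r x z) * u z + fine t2.
    by rewrite Sdiff; ring.
  rewrite (le_trans (ler_normD _ _))// mulr2n mulrDl mul1r lerD//.
    apply: le_trans (ler_norm_sum _ _ _) _; apply: ler_sum => z _.
    by rewrite normrM ler_piMr// ger0_norm.
  by rewrite ger0_norm// (le_trans t2t1).
move=> e e0.
have err_small : \forall h \near 0^'+, err h / h < e / 2.
  have c : err h / h @[h --> 0^'+] --> (0 : R).
    have S0 : (0 : R) = \sum_(z <- S) 0 by rewrite big1.
    rewrite [X in _ --> X]S0.
    have -> : (fun h => err h / h) = fun h => \sum_(z <- S)
        (`|p h x z - (z == x)%:R - h * q_matrix r x z| / h).
      by apply/funext => h; rewrite /err mulr_suml.
    apply: cvg_big => [|z _]; first exact: add_continuous.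
    have H : `|(p h x z - (z == x)%:R) / h - q_matrix r x z| @[h --> 0^'+] --> (0 : R).
      have q00 : (0 : R) = `|q_matrix r x z - q_matrix r x z| by rewrite subrr normr0.
      rewrite [X in _ --> X]q00.
      apply: cvg_norm; apply: cvgB; last exact: cvg_cst.
      exact: (ctmc_rates hp).
    have EQ : \forall h \near 0^'+,
        `|(p h x z - (z == x)%:R) / h - q_matrix r x z| =
        `|p h x z - (z == x)%:R - h * q_matrix r x z| / h.
      near=> h.
      have h0 : 0 < h by near: h; exact: nbhs_right_gt.
      rewrite -[X in _ - X](mulfK (lt0r_neq0 h0)) -mulrBl (mulrC _ h) normrM.
      by rewrite [X in _ * X]gtr0_norm// invr_gt0.
    exact: (cvg_trans (near_eq_cvg EQ) H).
  have e20 : 0 < e / 2 by rewrite divr_gt0.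
  exact: (cvgr_lt _ c _ e20).
move: err_small => /nbhs_ballP[d /= d0 Hd]; exists d => // h s /andP[h0 hd] s0.
apply: le_trans (err_bound _ _ (ltW h0) s0) _.
have : err h / h < e / 2 by apply: Hd => //=; rewrite /ball/= sub0r normrN gtr0_norm.
rewrite ltr_pdivrMr// => /ltW; lra.
Unshelve. all: by end_near.
Qed.

(** [chain_gen] is, at each [x], a finite linear combination of values, and such combinations
    preserve uniform right derivatives. *)
Lemma iter_transport_rderiv k x :
  unif_rderiv (fun s => iter k chain_gen (transport g s) x)
              (fun s => iter k.+1 chain_gen (transport g s) x).
Proof.
elim: k x => [|k IH] x; first exact: transport_rderiv.
rewrite /= /chain_gen; apply: unif_rderiv_sum => i; apply: unif_rderivZ.
have /(unif_rderivZ (-1)) Hx := IH x.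
have := unif_rderivD (IH (tgt x i)) Hx.
by under [in X in unif_rderiv X]eq_fun do rewrite mulN1r;
   under [X in unif_rderiv _ X]eq_fun do rewrite mulN1r.
Qed.

End Transport.
End Chain.

(** * Shock configurations and their densities *)

Section Markers.
Variables n N : nat.
Implicit Types (x y : shock_config n N) (i j : 'I_N) (k : int).

Lemma pos_lt x i j : (i < j)%N -> pos x i < pos x j.
Proof. by move=> ij; have /forallP/(_ i)/forallP/(_ j)/implyP := valP x; apply. Qed.

Lemma pos_inj x : injective (pos x).
Proof.
move=> i j E; apply/val_inj; case: (ltngtP i j) => // /(pos_lt x).
  by rewrite E ltxx.
by rewrite E ltxx.
Qed.

Lemma pos_le x i j : (i <= j)%N -> pos x i <= pos x j.
Proof.
by rewrite leq_eqVlt => /predU1P[/val_inj->//|/(pos_lt x)/ltW].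
Qed.

Lemma ltn_pos x i j : pos x i < pos x j -> (i < j)%N.
Proof. by move=> ij; rewrite ltnNge; apply/negP => /(pos_le x); rewrite leNgt ij. Qed.

(** A marker numbered between [i] and [j] would have its position strictly between two neighbouring
    sites. *)
Lemma adjacent_markers x i j : pos x j = pos x i + 1 -> j = i.+1 :> nat.
Proof.
move=> E; have ij : (i < j)%N by apply: (@ltn_pos x); lia.
apply/eqP; rewrite eqn_leq ij andbT leqNgt; apply/negP => ij1.
have i1N : (i.+1 < N)%N by rewrite (leq_trans ij1)// ltnW.
have := @pos_lt x i (Ordinal i1N) (ltnSn _).
have := @pos_lt x (Ordinal i1N) j ij1.
lia.
Qed.

Lemma marker_or_gap x k :
  (exists i, pos x i = k) \/
  ((forall i, pos x i != k) /\ exists2 j, (j <= N)%N & in_gap x j k).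
Proof.
case: (pickP (fun i => pos x i == k)) => [i /eqP|noi]; first by left; exists i.
right; split=> [i|]; first by rewrite noi.
(* The number of markers to the left of [k]; the empty maximum 0 is the gap that extends to minus
   infinity. *)
pose j := \max_(i | pos x i < k) i.+1.
exists j => [|i]; first by apply/bigmax_leqP => i _.
split=> [|ji].
  rewrite ltNge => ij; apply/negP => ki; move: ij; rewrite ltnNge => /negP; apply.
  apply/bigmax_leqP => i' i'k; apply: (@ltn_pos x); exact: lt_le_trans ki.
rewrite ltNge le_eqVlt noi/=; apply/negP => ik; move: ji; rewrite leqNgt => /negP; apply.
exact: (@leq_bigmax_cond _ (fun i => pos x i < k) (fun i : 'I_N => i.+1) i ik).
Qed.

Lemma in_gap_succ x (j : nat) k : in_gap x j k -> (forall i, pos x i != k + 1) ->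
  in_gap x j (k + 1).
Proof.
move=> g nm i; have [H1 H2] := g i; split=> [/H1|/H2]; first by lia.
have := nm i; lia.
Qed.

(** A gap is numbered by the count of markers to its left, and markers are numbered from 0: marker
    [i] has gap [i] on its left and gap [i.+1] on its right. *)
Lemma in_gap_left x i k : pos x i = k + 1 -> (forall i', pos x i' != k) ->
  in_gap x i k.
Proof.
move=> pi nm i'; split=> [/(pos_lt x)|/(pos_le x)]; have := nm i'; lia.
Qed.

Lemma in_gap_right x i k : pos x i = k -> (forall i', pos x i' != k + 1) ->
  in_gap x i.+1 (k + 1).
Proof.
move=> pi nm i'; split=> [|/(pos_lt x)]; last by have := nm i'; lia.
by rewrite ltnS => /(pos_le x); lia.
Qed.

Lemma jump_right_increasing x i : (forall j, pos x j != pos x i + 1) ->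
  increasing_pos (jump x i 1).1.
Proof.
move=> nm; apply/forallP => i1; apply/forallP => i2; apply/implyP => i12.
rewrite !ffunE; have := pos_lt x i12.
have [E1|_] := eqVneq i1 i; have [E2|_] := eqVneq i2 i; subst.
- by lia.
- by have := nm i2; lia.
- by lia.
- by [].
Qed.

Lemma jump_left_increasing x i : (forall j, pos x j != pos x i - 1) ->
  increasing_pos (jump x i (-1)).1.
Proof.
move=> nm; apply/forallP => i1; apply/forallP => i2; apply/implyP => i12.
rewrite !ffunE; have := pos_lt x i12.
have [E1|_] := eqVneq i1 i; have [E2|_] := eqVneq i2 i; subst.
- by lia.
- by lia.
- by have := nm i1; lia.
- by [].
Qed.

End Markers.

(** * One-site marginals of a probability on configurations *)

Section Marginals.
Variables (R : realType) (n : nat).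
Implicit Types (mu : probability (config n) R).

Definition marginal mu (k : int) (a : 'I_n.+1) : R :=
  fine (mu [set eta : config n | eta k = a]).

Lemma marginal_fin mu k a : mu [set eta : config n | eta k = a] \is a fin_num.
Proof. by apply: fin_num_measure; apply: measurable_coord. Qed.

Lemma marginal_ge0 mu k a : 0 <= marginal mu k a.
Proof. exact: fine_ge0. Qed.

Lemma sum_marginal mu k : \sum_a marginal mu k a = 1.
Proof.
have H := @measure_bigsetU_ord _ _ _ mu n.+1 xpredT
  (fun a => [set eta : config n | eta k = a]) (fun a => @measurable_coord n k a).
have T : trivIset setT (fun a => [set eta : config n | eta k = a]).
  by move=> a b _ _ [eta [/= <- <-]].
have E : \big[setU/set0]_(a < n.+1) [set eta : config n | eta k = a] = setT.
  by apply/seteqP; split=> // eta _; rewrite (bigD1 (eta k))//=; left.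
have P1 : mu setT = 1%E by exact: probability_setT.
move: (H T); rewrite E => /(etrans (esym P1))/(congr1 fine)/= ->.
rewrite (eq_bigr (fun a => (marginal mu k a)%:E)) ?sumEFin// => a _.
by rewrite fineK// marginal_fin.
Qed.

(** The remaining marginal probabilities are nonnegative with sum 0. *)
Lemma marginal_eq1 mu k b : marginal mu k b = 1 ->
  forall a, marginal mu k a = (a == b)%:R.
Proof.
move=> E a; have := sum_marginal mu k; rewrite (bigD1 b)//= E.
rewrite -[X in _ = X]addr0 => /addrI/eqP.
rewrite psumr_eq0; last by move=> *; exact: marginal_ge0.
move=> /allP/(_ a); rewrite mem_index_enum => /(_ isT)/implyP.
by have [->|ab /(_ isT)/eqP] := eqVneq a b.
Qed.

Lemma marginal_two mu k b c r : b != c -> marginal mu k b = r ->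
  marginal mu k c = 1 - r ->
  forall a, marginal mu k a = r * (a == b)%:R + (1 - r) * (a == c)%:R.
Proof.
move=> bc Eb Ec a; have := sum_marginal mu k.
rewrite (bigD1 b)//= (bigD1 c)/=; last by rewrite eq_sym.
rewrite Eb Ec; set S := \sum_(i < _ | _) _ => E.
have /eqP : S = 0 by move: E; lra.
rewrite psumr_eq0; last by move=> *; exact: marginal_ge0.
move=> /allP/(_ a); rewrite mem_index_enum => /(_ isT)/implyP.
have [->|ab] := eqVneq a b; first by rewrite (negbTE bc) mulr1 mulr0 addr0.
have [->|ac] := eqVneq a c; first by rewrite mulr0 mulr1 add0r.
by move=> /(_ isT)/eqP ->; rewrite !mulr0 addr0.
Qed.

End Marginals.

(** * Algebra of the densities and of the jump rates *)

Section Densities.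
Variables (R : realType) (q lambda : R) (N : nat).
Hypothesis q1 : 1 < q.
Let q0 : 0 < q := lt_trans ltr01 q1.
Local Notation rho := (rho q lambda N).
Local Notation v := (shock_v q lambda N).

(** Crossing a marker multiplies the fugacity [z] by [q ^+ 2]. All relations between neighbouring
    densities become rational identities in [q] and [z]. *)
Lemma rhoE i : exists2 z, 0 < z &
  rho i = z / (1 + z) /\ rho i.+1 = q ^+ 2 * z / (1 + q ^+ 2 * z).
Proof.
exists (q `^ (2 * i%:R - N%:R + lambda)); first exact: powR_gt0.
split=> //; rewrite /Defs.rho.
have -> : 2 * i.+1%:R - N%:R + lambda = 2%:R + (2 * i%:R - N%:R + lambda).
  by rewrite -natr1; ring.
rewrite powRD; last by rewrite (gt_eqF q0) implybT.
by rewrite powR_mulrn ?ltW.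
Qed.

Lemma shock_vE i : exists2 z, 0 < z & [/\ rho i = z / (1 + z),
  rho i.+1 = q ^+ 2 * z / (1 + q ^+ 2 * z) &
  v i = q * (1 + z) / (1 + q ^+ 2 * z)].
Proof.
have [z z0 [E0 E1]] := rhoE i; exists z => //; split=> //.
rewrite /shock_v E0 E1.
have q2 : q ^+ 2 - 1 != 0 by rewrite subr_eq0 gt_eqF// exprn_egt1.
have z1 : 1 + z != 0 by rewrite gt_eqF// addr_gt0.
have qz1 : 1 + q ^+ 2 * z != 0 by rewrite gt_eqF// addr_gt0// mulr_gt0// exprn_gt0.
field; rewrite z1 qz1 (gt_eqF q0)/= andbT.
have -> : q ^+ 2 * z * (1 + z) + - z * (1 + q ^+ 2 * z) = z * (q ^+ 2 - 1) by ring.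
by rewrite mulf_neq0// gt_eqF.
Qed.

Lemma shock_v_gt0 i : 0 < v i.
Proof.
have [z z0 [_ _ ->]] := shock_vE i.
by rewrite divr_gt0 ?mulr_gt0 ?addr_gt0 ?mulr_gt0 ?exprn_gt0.
Qed.

(** What a jump to the right needs: the first two relations balance an [ord_max] and an [ord0] that
    cross the marker, the third one matches the step of the density with the bulk current on the
    right. *)
Lemma shock_v_relations i :
  [/\ q^-1 * rho i.+1 = v i * rho i,
      q * (1 - rho i.+1) = v i * (1 - rho i) &
      v i * (rho i - rho i.+1) = - ((q - q^-1) * rho i.+1 * (1 - rho i.+1))].
Proof.
have [z z0 [-> -> ->]] := shock_vE i.
have z1 : 1 + z != 0 by rewrite gt_eqF// addr_gt0.
have qz1 : 1 + q ^+ 2 * z != 0 by rewrite gt_eqF// addr_gt0// mulr_gt0// exprn_gt0.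
by split; field; rewrite ?z1 ?qz1 ?(gt_eqF q0).
Qed.

Lemma shock_vV_relations i :
  [/\ q * rho i = (v i)^-1 * rho i.+1,
      q^-1 * (1 - rho i) = (v i)^-1 * (1 - rho i.+1) &
      (v i)^-1 * (rho i - rho i.+1) = - ((q - q^-1) * rho i * (1 - rho i))].
Proof.
have [z z0 [-> -> ->]] := shock_vE i.
have z1 : 1 + z != 0 by rewrite gt_eqF// addr_gt0.
have qz1 : 1 + q ^+ 2 * z != 0 by rewrite gt_eqF// addr_gt0// mulr_gt0// exprn_gt0.
by split; field; rewrite ?z1 ?qz1 ?(gt_eqF q0).
Qed.

End Densities.

(** * Two-site identities for each kind of bond *)

Section LocalIdentities.
Variables (R : realType) (n : nat) (w q lambda : R) (N : nat).
Hypotheses (hn : (1 <= n)%N) (q1 : 1 < q).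
Local Notation rho := (rho q lambda N).
Local Notation v := (shock_v q lambda N).
Local Notation c := (@asep_rate R n w q).
Implicit Types (a b : 'I_n.+1) (j : nat).

Lemma max_neq0 : (ord_max : 'I_n.+1) != ord0.
Proof. by rewrite -val_eqE/= -lt0n. Qed.

Variant color_spec a : Prop :=
| ColorBottom of a = ord0
| ColorTop of a = ord_max
| ColorMiddle of (a == ord0) = false & (a == ord_max) = false.

Lemma color_cases a : color_spec a.
Proof.
have [->|a0] := eqVneq a ord0; first exact: ColorBottom.
have [->|am] := eqVneq a ord_max; first exact: ColorTop.
by apply: ColorMiddle; exact: negbTE.
Qed.

Lemma asep_rate_gt a b : (b < a)%N -> c a b = w * q.
Proof.
move=> ba; rewrite /asep_rate gtr0_sgz ?subr_gt0 ?ltz_nat// expr1z.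
by rewrite -val_eqE/= gtn_eqF// subr0.
Qed.

Lemma asep_rate_lt a b : (a < b)%N -> c a b = w * q^-1.
Proof.
move=> ab; rewrite /asep_rate ltr0_sgz ?subr_lt0 ?ltz_nat// exprN1.
by rewrite -val_eqE/= ltn_eqF// subr0.
Qed.

Lemma asep_rate_eq a : c a a = 0.
Proof. by rewrite /asep_rate subrr sgz0 expr0z eqxx subrr mulr0. Qed.

Definition bulk j a : R := rho j * (a == ord_max)%:R + (1 - rho j) * (a == ord0)%:R.

(** The signed measure [G] at a site of gap [j]. *)
Definition bulk_current j a : R :=
  w * (q - q^-1) * rho j * (1 - rho j) * ((a == ord0)%:R - (a == ord_max)%:R).

(** Inside a gap, gain minus loss is a discrete gradient. Only the pairs made of one [ord0] and one
    [ord_max] contribute, because of the asymmetry [q - q^-1]. *)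
Lemma bulk_bond j a b :
  c b a * (bulk j b * bulk j a) - c a b * (bulk j a * bulk j b) =
  bulk_current j a * bulk j b - bulk j a * bulk_current j b.
Proof.
have m0 := negbTE max_neq0.
have n0 : (ord0 : 'I_n.+1) == ord_max = false by rewrite eq_sym.
have lt0 : ((ord0 : 'I_n.+1) < (ord_max : 'I_n.+1))%N by [].
rewrite /bulk /bulk_current.
case: (color_cases a) => [->|->|a0 am]; case: (color_cases b) => [->|->|b0 bm];
  rewrite ?a0 ?am ?b0 ?bm ?eqxx ?m0 ?n0 ?asep_rate_eq
    ?(asep_rate_gt lt0) ?(asep_rate_lt lt0) /=; ring.
Qed.

(** A bulk value passing from gap [j] over the marker amounts to a jump of the marker to the left.
    Since [b < n] and [a != b], the order of [a] and [b] is decided by [a] alone, so markers of all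
    colours jump at the same rate. *)
Lemma bulk_left j a b : (b < n)%N -> a != b ->
  c a b * bulk j a = w * (v j)^-1 * bulk j.+1 a.
Proof.
move=> bn ab; have [E1 E2 _] := shock_vV_relations lambda N q1 j.
rewrite /bulk; case: (color_cases a) => [Ea|Ea|-> ->]; last by rewrite /=; ring.
  rewrite Ea eqxx eq_sym (negbTE max_neq0) asep_rate_lt; last first.
    by rewrite lt0n; apply: contraNneq ab => b0; rewrite Ea -val_eqE/= b0.
  by rewrite !mulr0 !mulr1 !add0r -mulrA E2 mulrA.
by rewrite Ea eqxx (negbTE max_neq0) asep_rate_gt// !mulr0 !mulr1 !addr0 -mulrA E1 mulrA.
Qed.

Lemma bulk_right j a b : (b < n)%N -> a != b ->
  c b a * bulk j.+1 a = w * v j * bulk j a.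
Proof.
move=> bn ab; have [E1 E2 _] := shock_v_relations lambda N q1 j.
rewrite /bulk; case: (color_cases a) => [Ea|Ea|-> ->]; last by rewrite /=; ring.
  rewrite Ea eqxx eq_sym (negbTE max_neq0) asep_rate_gt; last first.
    by rewrite lt0n; apply: contraNneq ab => b0; rewrite Ea -val_eqE/= b0.
  by rewrite !mulr0 !mulr1 !add0r -mulrA E2 mulrA.
by rewrite Ea eqxx (negbTE max_neq0) asep_rate_lt// !mulr0 !mulr1 !addr0 -mulrA E1 mulrA.
Qed.

Lemma bulk_current_left j a :
  bulk_current j a = w * (v j)^-1 * (bulk j a - bulk j.+1 a).
Proof.
have [_ _ E] := shock_vV_relations lambda N q1 j.
rewrite /bulk_current /bulk.
transitivity (- w * ((v j)^-1 * (rho j - rho j.+1)) *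
  ((a == ord0)%:R - (a == ord_max)%:R)); first by rewrite E; ring.
by ring.
Qed.

Lemma bulk_current_right j a :
  bulk_current j.+1 a = w * v j * (bulk j a - bulk j.+1 a).
Proof.
have [_ _ E] := shock_v_relations lambda N q1 j.
rewrite /bulk_current /bulk.
transitivity (- w * (v j * (rho j - rho j.+1)) *
  ((a == ord0)%:R - (a == ord_max)%:R)); first by rewrite E; ring.
by ring.
Qed.

(** The bond to the left of a marker of colour [d]: its jump to the left plus the current of the
    gap. The case [a = b = d] matters for [d = 0]: the exchange is then invisible, and the current
    compensates the jump. *)
Lemma marker_left_bond j a b (d : 'I_n.+1) : (d < n)%N ->
  c b a * (bulk j b * (a == d)%:R) - c a b * (bulk j a * (b == d)%:R) =
  w * (v j)^-1 * ((a == d)%:R * bulk j.+1 b - bulk j a * (b == d)%:R)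
  + bulk_current j a * (b == d)%:R.
Proof.
move=> dn; rewrite bulk_current_left.
have [->|ad] := eqVneq a d; have [->|bd] := eqVneq b d.
- by rewrite asep_rate_eq /=; ring.
- by rewrite /= !(mulr1n, mulr0n, mulr1, mulr0, mul1r, subr0, addr0) bulk_left.
- by rewrite /= !(mulr1n, mulr0n, mulr1, mulr0, mul0r, sub0r, mul1r) bulk_left//; ring.
- by rewrite /=; ring.
Qed.

Lemma marker_right_bond j a b (d : 'I_n.+1) : (d < n)%N ->
  c b a * ((b == d)%:R * bulk j.+1 a) - c a b * ((a == d)%:R * bulk j.+1 b) =
  w * v j * (bulk j a * (b == d)%:R - (a == d)%:R * bulk j.+1 b)
  - (a == d)%:R * bulk_current j.+1 b.
Proof.
move=> dn; rewrite bulk_current_right.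
have [->|ad] := eqVneq a d; have [->|bd] := eqVneq b d.
- by rewrite asep_rate_eq /=; ring.
- by rewrite /= !(mulr1n, mulr0n, mulr1, mulr0, mul1r, mul0r, sub0r) bulk_right//; ring.
- by rewrite /= !(mulr1n, mulr0n, mulr1, mulr0, mul0r, subr0, mul1r) bulk_right//.
- by rewrite /=; ring.
Qed.

(** The weights charge only the patterns [(d, e)] and [(e, d)], both reached from [(d, e)], so the
    rate can be read off at [(d, e)]. *)
Lemma marker_marker_bond a b (d e : 'I_n.+1) :
  c b a * ((b == d)%:R * (a == e)%:R) - c a b * ((a == d)%:R * (b == e)%:R) =
  c d e * ((a == e)%:R * (b == d)%:R - (a == d)%:R * (b == e)%:R).
Proof.
have [Eae|_] := eqVneq a e; have [Ebd|_] := eqVneq b d;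
  have [Ead|_] := eqVneq a d; have [Ebe|_] := eqVneq b e; subst; try by rewrite /=; ring.
all: by rewrite ?Ebd ?Eae ?asep_rate_eq /=; ring.
Qed.

(** The three terms of [swap_rate] are the single ASEP rate split according to which colours
    vanish. *)
Lemma swap_rateE (a b : nat) (d e : 'I_n.+1) : a = d -> b = e ->
  swap_rate w q a b = c d e.
Proof.
move=> -> ->; rewrite /swap_rate /asep_rate.
rewrite -val_eqE/=; have [->|d0] := eqVneq (d : nat) 0%N; have [->|e0] := eqVneq (e : nat) 0%N.
- by rewrite -[sgz (0%Z - 0%Z)]/(0 : int) expr0z /=; ring.
- by rewrite ltr0_sgz ?subr_lt0 ?ltz_nat ?lt0n// exprN1 /=; ring.
- by rewrite gtr0_sgz ?subr_gt0 ?ltz_nat ?lt0n// expr1z (negbTE d0) /=; ring.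
- by rewrite /=; ring.
Qed.

End LocalIdentities.

(** * The shock exclusion process as a chain with labelled transitions *)

Section Transitions.
Variables (R : realType) (n N : nat) (w q lambda : R).
Hypotheses (w0 : 0 < w) (q1 : 1 < q).
Let q0 : 0 < q := lt_trans ltr01 q1.
Local Notation v := (shock_v q lambda N).
Implicit Types (x y : shock_config n N) (i j : 'I_N) (k : int).

(** Jumps to the right, jumps to the left, and colour exchanges. Exchanges are indexed by all pairs
    of markers; their rate vanishes unless the second marker sits just to the right of the first. *)
Definition transition : finType := ('I_N + 'I_N + 'I_N * 'I_N)%type.
Implicit Type s : transition.

Definition raw_target x s :=
  match s with
  | inl (inl i) => jump x i 1
  | inl (inr i) => jump x i (-1)
  | inr (i, j) => swap_col x i j
  end.

(** A move that breaks the order of the positions is sent back to [x], where it does not count in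
    [chain_gen]. *)
Definition target x s : shock_config n N := insubd x (raw_target x s).

Definition transition_rate x s : R :=
  match s with
  | inl (inl i) => w * v i * (~~ blocked_right x i)%:R
  | inl (inr i) => w * (v i)^-1 * (~~ blocked_left x i)%:R
  | inr (i, j) => swap_rate w q (colour x i) (colour x j)
                  * (pos x j == pos x i + 1)%:R
  end.

(* The transition [s] modifies the sites [transition_bond x s] and
   [transition_bond x s + 1] only. *)
Definition transition_bond x s : int :=
  match s with
  | inl (inl i) => pos x i
  | inl (inr i) => pos x i - 1
  | inr (i, _) => pos x i
  end.

Lemma val_target x s : increasing_pos (raw_target x s).1 ->
  val (target x s) = raw_target x s.
Proof. by move=> H; rewrite /target val_insubd H. Qed.

Lemma eq_target x y s : y != x -> (y == target x s) = (val y == raw_target x s).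
Proof.
move=> yx; rewrite /target -val_eqE val_insubd; case: ifPn => //= H.
rewrite (negbTE (_ : val y != val x)) ?val_eqE//.
by apply/esym/negbTE; apply: contraNneq H => <-; exact: (valP y).
Qed.

Lemma big_transition (F : transition -> R) : \sum_s F s =
  (\sum_i F (inl (inl i)) + \sum_i F (inl (inr i))) + \sum_i \sum_j F (inr (i, j)).
Proof. by rewrite !big_sumType/= pair_bigA/=; congr (_ + _); apply: eq_bigr => -[]. Qed.

Lemma shock_rate_targets x y : y != x ->
  shock_rate w q lambda x y = \sum_s transition_rate x s * (y == target x s)%:R.
Proof.
move=> yx; rewrite big_transition /shock_rate big_split/=.
congr (_ + _ + _).
- by apply: eq_bigr => i _; rewrite eq_target.
- by apply: eq_bigr => i _; rewrite eq_target.
apply: eq_bigr => i _; rewrite big_mkcond/=; apply: eq_bigr => j _.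
rewrite eq_target//=; case: ifPn => // ji.
have [/adjacent_markers/eqP E|_] := eqVneq (pos x j) (pos x i + 1).
  by rewrite E in ji.
by rewrite mulr0 mul0r.
Qed.

(** The colour of a marker as a site value; it is never [ord_max]. *)
Definition site_colour x i : 'I_n.+1 := widen_ord (leqnSn n) (colour x i).

Lemma colour_swap_rate x i j : swap_rate w q (colour x i) (colour x j) =
  asep_rate w q (site_colour x i) (site_colour x j).
Proof. exact: swap_rateE. Qed.

Lemma transition_rate_ge0 x s : 0 <= transition_rate x s.
Proof.
have v0 i := shock_v_gt0 lambda N q1 i.
case: s => [[i|i]|[i j]] /=; rewrite mulr_ge0//.
- by rewrite mulr_ge0// ltW.
- by rewrite mulr_ge0 ?invr_ge0// ltW.
rewrite colour_swap_rate /asep_rate mulr_ge0 ?(ltW w0)//.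
case: eqP => [->|_]; first by rewrite subrr sgz0 expr0z subrr.
by rewrite subr0 exprz_ge0// ltW.
Qed.

Definition total_rate_bound : R :=
  \sum_(i < N) w * v i + \sum_(i < N) w * (v i)^-1 +
  \sum_(i < N) \sum_(j < N) w * q.

Lemma sum_transition_rate x : \sum_s transition_rate x s <= total_rate_bound.
Proof.
have v0 i := shock_v_gt0 lambda N q1 i.
have le_b (c : R) (b : bool) : 0 <= c -> c * b%:R <= c.
  by case: b => c0; rewrite ?mulr1// mulr0.
rewrite big_transition /total_rate_bound; apply: lerD; first apply: lerD.
- by apply: ler_sum => i _; apply: le_b; rewrite mulr_ge0// ltW.
- by apply: ler_sum => i _; apply: le_b; rewrite mulr_ge0 ?invr_ge0// ltW.
apply: ler_sum => i _; apply: ler_sum => j _ /=; rewrite colour_swap_rate.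
apply: le_trans (ler_norm _) _; rewrite normrM normr_nat.
apply: le_trans (asep_rate_bound w0 q1 (site_colour x i) (site_colour x j)).
exact: le_b.
Qed.

Lemma total_rate_bound_ge0 : 0 <= total_rate_bound.
Proof.
have v0 i := shock_v_gt0 lambda N q1 i.
rewrite /total_rate_bound !addr_ge0//; apply: sumr_ge0 => i _.
- by rewrite mulr_ge0// ltW.
- by rewrite mulr_ge0 ?invr_ge0// ltW.
- by rewrite sumr_ge0// => j _; rewrite mulr_ge0// ltW.
Qed.

End Transitions.

(** * Shock measures and the generator *)

Lemma big_seqD2 (R : comRingType) (T : eqType) (W : seq T) (k l : T) (F : T -> R) :
  uniq W -> k \in W -> l \in W -> l != k ->
  \prod_(i <- W) F i = F k * F l * \prod_(i <- W | (i != k) && (i != l)) F i.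
Proof.
move=> uW kW lW lk; rewrite (bigD1_seq k)//= -mulrA; congr (_ * _).
rewrite -big_filter (bigD1_seq l) ?filter_uniq ?mem_filter ?lk//=.
by rewrite big_filter_cond.
Qed.

Section ShockMeasures.
Variables (R : realType) (n N : nat) (w q lambda : R).
Hypotheses (hn : (1 <= n)%N) (q1 : 1 < q).
Variable nu : shock_config n N -> probability (config n) R.
Hypothesis hnu : forall y, shock_measure q lambda y (nu y).
Implicit Types (x y : shock_config n N) (i j : 'I_N) (k l : int) (a b : 'I_n.+1).
Implicit Types (W : seq int) (xi : config n).
Local Notation mg y := (marginal (nu y)).
Local Notation rate := (transition_rate w q lambda).
Local Notation bulkq := (bulk q lambda N).
Local Notation bulk_currentq := (bulk_current w q lambda N).

Lemma site_colour_lt x i : (site_colour x i < n)%N.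
Proof. exact: (ltn_ord (colour x i)). Qed.

Lemma marginal_marker x i a : mg x (pos x i) a = (a == site_colour x i)%:R.
Proof.
apply: marginal_eq1; rewrite /marginal.
rewrite (_ : [set eta : config n | eta (pos x i) = site_colour x i] =
  [set eta : config n | eta (pos x i) = colour x i :> nat]); last first.
  by apply/seteqP; split=> eta /= => [->//|E]; exact: val_inj.
by rewrite (shock_marker (hnu x)).
Qed.

Lemma marginal_gap x (j : nat) k a : (j <= N)%N -> in_gap x j k -> mg x k a = bulkq j a.
Proof.
move=> jN g; have [E1 E2] := shock_bulk (hnu x) jN g.
by apply: marginal_two; rewrite ?max_neq0// /marginal ?E1 ?E2.
Qed.

(** The marginal at [l] is determined by the colour of a marker at [l] or, failing that, by the
    number of markers to its left. *)
Lemma marginal_eq_site x y l :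
  (forall i, pos x i = l -> pos y i = l /\ colour y i = colour x i) ->
  (forall i, (pos x i < l -> pos y i < l) /\ (l < pos x i -> l < pos y i)) ->
  mg y l =1 mg x l.
Proof.
move=> Hm Hg a; have [[i xi]|[_ [j jN g]]] := marker_or_gap x l.
  have [yi ci] := Hm i xi.
  by rewrite -{1}yi -xi !marginal_marker /site_colour ci.
rewrite !(marginal_gap _ jN)// => i; have [H1 H2] := g i; have [H3 H4] := Hg i.
by split=> [/H1/H3|/H2/H4].
Qed.

Definition window_prob W xi y : R := \prod_(l <- W) mg y l (xi l).

Lemma fine_nu_cyl W xi y : uniq W -> fine (nu y (cyl W xi)) = window_prob W xi y.
Proof.
move=> uW; rewrite (shock_product (hnu y) _ uW) /window_prob.
elim: W {uW} => [|l W IH]; first by rewrite !big_nil.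
rewrite !big_cons fineM ?IH ?marginal_fin//.
by apply: prode_fin_num => *; exact: marginal_fin.
Qed.

(** The signed measure [G k], written with marginals so that one formula covers bulk sites and
    markers: at a marker the marginal of [ord_max] is 0. *)
Definition current x k a : R :=
  w * (q - q^-1) * mg x k ord_max * mg x k ord0 * ((a == ord0)%:R - (a == ord_max)%:R).

Lemma current_marker x i a : current x (pos x i) a = 0.
Proof.
rewrite /current marginal_marker -val_eqE/=.
by rewrite gtn_eqF ?site_colour_lt// mulr0 !mul0r.
Qed.

Lemma current_gap x (j : nat) k a : (j <= N)%N -> in_gap x j k ->
  current x k a = bulk_currentq j a.
Proof.
move=> jN g; rewrite /current !(marginal_gap _ jN g) /bulk /bulk_current.
rewrite !eqxx (negbTE (max_neq0 hn)) eq_sym (negbTE (max_neq0 hn)) /=; ring.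
Qed.

Definition current_prob W xi x k : R :=
  current x k (xi k) * \prod_(l <- W | l != k) mg x l (xi l).

Definition bond_jumps W xi x k : R :=
  \sum_s (transition_bond x s == k)%:R *
    (rate x s * (window_prob W xi (target x s) - window_prob W xi x)).

Lemma bond_jumps_eq0 W xi x k :
  (forall s, transition_bond x s = k -> rate x s = 0) -> bond_jumps W xi x k = 0.
Proof.
move=> H; rewrite /bond_jumps big1// => s _.
by case: eqP => [/H->|_]; rewrite ?mul0r// mulr0.
Qed.

Lemma bond_jumps_single W xi x s0 :
  (forall s, s != s0 -> transition_bond x s = transition_bond x s0 -> rate x s = 0) ->
  bond_jumps W xi x (transition_bond x s0) =
  rate x s0 * (window_prob W xi (target x s0) - window_prob W xi x).
Proof.
move=> H; rewrite /bond_jumps (bigD1 s0)//= eqxx mul1r big1 ?addr0// => s ss0.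
by case: eqP => [/(H _ ss0)->|_]; rewrite ?mul0r// mulr0.
Qed.

Section Bond.
Variables (W : seq int) (xi : config n) (x : shock_config n N) (k : int).
Hypotheses (uW : uniq W) (kW : k \in W) (k1W : k + 1 \in W).

Let rest : R := \prod_(l <- W | (l != k) && (l != k + 1)) mg x l (xi l).

Let k1k : k + 1 != k. Proof. by rewrite gt_eqF// ltrDl. Qed.

Lemma window_prob_bond y :
  (forall l, l != k -> l != k + 1 -> mg y l =1 mg x l) ->
  window_prob W xi y = mg y k (xi k) * mg y (k + 1) (xi (k + 1)) * rest.
Proof.
move=> H; rewrite /window_prob (big_seqD2 _ uW kW k1W k1k); congr (_ * _).
by apply: eq_bigr => l /andP[lk lk1]; exact: H.
Qed.

Lemma window_prob_exchange : window_prob W (exchange k xi) x =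
  mg x k (xi (k + 1)) * mg x (k + 1) (xi k) * rest.
Proof.
rewrite /window_prob (big_seqD2 _ uW kW k1W k1k); congr (_ * _).
  by rewrite /exchange eqxx (negbTE k1k) eqxx.
by apply: eq_bigr => l /andP[lk lk1]; rewrite /exchange (negbTE lk) (negbTE lk1).
Qed.

Lemma current_prob_left :
  current_prob W xi x k = current x k (xi k) * mg x (k + 1) (xi (k + 1)) * rest.
Proof.
rewrite /current_prob -big_filter (bigD1_seq (k + 1)) ?filter_uniq ?mem_filter ?k1k//=.
by rewrite big_filter_cond mulrA.
Qed.

Lemma current_prob_right : current_prob W xi x (k + 1) =
  mg x k (xi k) * current x (k + 1) (xi (k + 1)) * rest.
Proof.
have kk1 : k != k + 1 by lia.
rewrite /current_prob -big_filter (bigD1_seq k) ?filter_uniq ?mem_filter ?kk1//=.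
rewrite big_filter_cond mulrA [current _ _ _ * _]mulrC; congr (_ * _).
by apply: eq_bigl => l; rewrite andbC.
Qed.

(** The left side is the gain from the exchanged pattern minus the loss. All terms share the factor
    [rest]; what remains is a two-site identity that depends on which of [k] and [k + 1] are
    markers. *)
Lemma bond_identity :
  asep_rate w q (xi (k + 1)) (xi k) * window_prob W (exchange k xi) x
  - asep_rate w q (xi k) (xi (k + 1)) * window_prob W xi x =
  bond_jumps W xi x k + current_prob W xi x k - current_prob W xi x (k + 1).
Proof.
rewrite window_prob_exchange current_prob_left current_prob_right.
have Wx : window_prob W xi x = mg x k (xi k) * mg x (k + 1) (xi (k + 1)) * rest.
  by apply: window_prob_bond.
set a := xi k in Wx *; set b := xi (k + 1) in Wx *.
(* [r] stands for the contribution of the shock transitions at the two sites. *)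
suff [r [Er E]] : exists r, bond_jumps W xi x k = r * rest /\
    asep_rate w q b a * (mg x k b * mg x (k + 1) a)
    - asep_rate w q a b * (mg x k a * mg x (k + 1) b) =
    r + current x k a * mg x (k + 1) b - mg x k a * current x (k + 1) b.
  rewrite Er Wx -mulrDl -mulrBl -E; ring.
have [[i xk]|[nk [j jN gk]]] := marker_or_gap x k;
  have [[i' xk1]|[nk1 _]] := marker_or_gap x (k + 1).
(* Two adjacent markers: jumps across the bond are blocked, and only their colour exchange is
   left. *)
- have i'i : pos x i' = pos x i + 1 by rewrite xk xk1.
  have ii' := adjacent_markers i'i.
  have i'ni : i' != i by rewrite -val_eqE/= ii' gtn_eqF.
  have incr : increasing_pos (raw_target x (inr (i, i'))).1 by exact: (valP x).
  have Ey := val_target incr; set y := target x _ in Ey.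
  have py : pos y = pos x by rewrite /pos Ey.
  have cy i0 : colour y i0 = if i0 == i then colour x i' else
      if i0 == i' then colour x i else colour x i0.
    by rewrite {1}/colour Ey ffunE.
  have mk a' : mg x k a' = (a' == site_colour x i)%:R by rewrite -xk marginal_marker.
  have mk1 a' : mg x (k + 1) a' = (a' == site_colour x i')%:R.
    by rewrite -xk1 marginal_marker.
  have yk a' : mg y k a' = (a' == site_colour x i')%:R.
    by rewrite -xk -py marginal_marker /site_colour cy eqxx.
  have yk1 a' : mg y (k + 1) a' = (a' == site_colour x i)%:R.
    by rewrite -xk1 -py marginal_marker /site_colour cy eqxx (negbTE i'ni).
  have Wy : window_prob W xi y = mg y k a * mg y (k + 1) b * rest.
    apply: window_prob_bond => l lk lk1; apply: marginal_eq_site => i0; rewrite py// => pl.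
    split=> //; rewrite cy; case: eqP => [E|_]; first by rewrite -pl E xk eqxx in lk.
    by case: eqP => [E|_//]; rewrite -pl E xk1 eqxx in lk1.
  exists (asep_rate w q (site_colour x i) (site_colour x i') *
    (mg y k a * mg y (k + 1) b - mg x k a * mg x (k + 1) b)); split.
    have bk : transition_bond x (inr (i, i')) = k by exact: xk.
    rewrite -[in LHS]bk bond_jumps_single -/y.
      by rewrite Wy Wx /= i'i eqxx mulr1 colour_swap_rate; ring.
    case=> [[i0|i0]|[i0 j0]] /= s0 => [/pos_inj ->|E|/pos_inj E].
    + rewrite (_ : blocked_right x i = true) ?mulr0//.
      by apply/existsP; exists i'; rewrite ii' i'i !eqxx.
    + have -> : i0 = i' by apply: (@pos_inj _ _ x); lia.
      rewrite (_ : blocked_left x i' = true) ?mulr0//.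
      by apply/existsP; exists i; rewrite ii' i'i addrK !eqxx.
    + rewrite E; case: eqP => [E1|_]; last by rewrite mulr0.
      have E2 : j0 = i' by apply: (@pos_inj _ _ x); rewrite E1 i'i.
      by rewrite E E2 eqxx in s0.
  have -> : current x k a = 0 by rewrite -xk current_marker.
  have -> : current x (k + 1) b = 0 by rewrite -xk1 current_marker.
  by rewrite !mk !mk1 yk yk1 mul0r mulr0 addr0 subr0 marker_marker_bond.
(* A marker at [k] and a bulk site at [k + 1]: only the jump of [i] to the right takes place
   here. *)
- have incr : increasing_pos (raw_target x (inl (inl i))).1.
    by apply: jump_right_increasing => i0; rewrite xk.
  have Ey := val_target incr; set y := target x _ in Ey.
  have py i0 : pos y i0 = if i0 == i then k + 1 else pos x i0.
    by rewrite /pos Ey ffunE xk.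
  have cy : colour y = colour x by rewrite /colour Ey.
  have gx : in_gap x i.+1 (k + 1) by exact: in_gap_right.
  have nx i0 : i0 != i -> pos x i0 != k.
    by move=> i0i; rewrite -xk (inj_eq (@pos_inj _ _ x)).
  have gy : in_gap y i k.
    by apply: in_gap_left => [|i0]; rewrite py ?eqxx//; case: ifPn => [_|/nx//]; lia.
  have mk a' : mg x k a' = (a' == site_colour x i)%:R by rewrite -xk marginal_marker.
  have mk1 a' : mg x (k + 1) a' = bulkq i.+1 a' by rewrite (marginal_gap _ _ gx).
  have yk a' : mg y k a' = bulkq i a' by rewrite (marginal_gap _ (ltnW _) gy).
  have yk1 a' : mg y (k + 1) a' = (a' == site_colour x i)%:R.
    have pk1 : pos y i = k + 1 by rewrite py eqxx.
    by rewrite -pk1 marginal_marker /site_colour cy.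
  have Wy : window_prob W xi y = mg y k a * mg y (k + 1) b * rest.
    apply: window_prob_bond => l lk lk1; apply: marginal_eq_site => i0.
      rewrite cy py => pl; split=> //; case: eqP => [E|//].
      by rewrite -pl E xk eqxx in lk.
    by rewrite py; case: eqP => [->|_]; [rewrite xk; split; lia|].
  exists (w * shock_v q lambda N i *
    (mg y k a * mg y (k + 1) b - mg x k a * mg x (k + 1) b)); split.
    have bk : transition_bond x (inl (inl i)) = k by exact: xk.
    rewrite -[in LHS]bk bond_jumps_single -/y.
      rewrite Wy Wx /= (_ : blocked_right x i = false) ?mulr1; first by ring.
      by apply/existsP => -[j0 /andP[_ /eqP]]; apply/eqP; rewrite xk.
    case=> [[i0|i0]|[i0 j0]] /= s0 => [/pos_inj E|E|/pos_inj E].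
    + by rewrite E eqxx in s0.
    + by have := nk1 i0; lia.
    + by rewrite E xk (negbTE (nk1 _)) mulr0.
  have -> : current x k a = 0 by rewrite -xk current_marker.
  rewrite (current_gap _ _ gx)// !mk !mk1 yk yk1 mul0r addr0.
  exact: marker_right_bond (site_colour_lt _ _).
(* A bulk site at [k] and a marker at [k + 1]: only the jump of [i'] to the left takes place
   here. *)
- have incr : increasing_pos (raw_target x (inl (inr i'))).1.
    by apply: jump_left_increasing => i0; rewrite xk1 addrK.
  have Ey := val_target incr; set y := target x _ in Ey.
  have py i0 : pos y i0 = if i0 == i' then k else pos x i0.
    by rewrite /pos Ey ffunE xk1 addrK.
  have cy : colour y = colour x by rewrite /colour Ey.
  have gx : in_gap x i' k by exact: in_gap_left.
  have nx i0 : i0 != i' -> pos x i0 != k + 1.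
    by move=> i0i; rewrite -xk1 (inj_eq (@pos_inj _ _ x)).
  have gy : in_gap y i'.+1 (k + 1).
    by apply: in_gap_right => [|i0]; rewrite py ?eqxx//; case: ifPn => [_|/nx//]; lia.
  have mk a' : mg x k a' = bulkq i' a' by rewrite (marginal_gap _ (ltnW _) gx).
  have mk1 a' : mg x (k + 1) a' = (a' == site_colour x i')%:R.
    by rewrite -xk1 marginal_marker.
  have yk1 a' : mg y (k + 1) a' = bulkq i'.+1 a' by rewrite (marginal_gap _ _ gy).
  have yk a' : mg y k a' = (a' == site_colour x i')%:R.
    have pk : pos y i' = k by rewrite py eqxx.
    by rewrite -pk marginal_marker /site_colour cy.
  have Wy : window_prob W xi y = mg y k a * mg y (k + 1) b * rest.
    apply: window_prob_bond => l lk lk1; apply: marginal_eq_site => i0.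
      rewrite cy py => pl; split=> //; case: eqP => [E|//].
      by rewrite -pl E xk1 eqxx in lk1.
    by rewrite py; case: eqP => [->|_]; [rewrite xk1; split; lia|].
  exists (w * (shock_v q lambda N i')^-1 *
    (mg y k a * mg y (k + 1) b - mg x k a * mg x (k + 1) b)); split.
    have bk : transition_bond x (inl (inr i')) = k by rewrite /= xk1 addrK.
    rewrite -[in LHS]bk bond_jumps_single -/y.
      rewrite Wy Wx /= (_ : blocked_left x i' = false) ?mulr1; first by ring.
      by apply/existsP => -[j0 /andP[_ /eqP]]; apply/eqP; rewrite xk1 addrK.
    case=> [[i0|i0]|[i0 j0]] /= s0 => [E|/addIr/pos_inj E|E].
    + by have := nk i0; rewrite E xk1 addrK eqxx.
    + by rewrite E eqxx in s0.
    + by have := nk i0; rewrite E xk1 addrK eqxx.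
  have -> : current x (k + 1) b = 0 by rewrite -xk1 current_marker.
  rewrite (current_gap _ (ltnW _) gx)// !mk !mk1 yk yk1 mulr0 subr0.
  exact: marker_left_bond (site_colour_lt _ _).
(* Two bulk sites of the same gap: no shock transition is located here. *)
- have gk1 := in_gap_succ gk nk1.
  exists 0; split.
    rewrite mul0r bond_jumps_eq0//.
    case=> [[i0|i0]|[i0 j0]] /= E.
    + by have := nk i0; rewrite E eqxx.
    + by have := nk1 i0; lia.
    + by have := nk i0; rewrite E eqxx.
  rewrite (current_gap _ jN gk) (current_gap _ jN gk1).
  by rewrite !(marginal_gap _ jN gk) !(marginal_gap _ jN gk1) add0r bulk_bond.
Qed.

End Bond.
End ShockMeasures.

(** * Summation over bonds and the intertwining relation *)

Lemma telescope_intv (R : zmodType) (F : int -> R) a l :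
  \sum_(k <- intv a l) (F k - F (k + 1)) = F a - F (a + l%:Z).
Proof.
rewrite /intv big_map; elim: l => [|l IH]; first by rewrite big_nil addr0 subrr.
by rewrite -addn1 iotaD big_cat/= IH big_seq1 add0n addrA subrK PoszD addrA.
Qed.

(** An involution that acts inside [W] only keeps the placeholder values of [ext], hence permutes
    the extended patterns. *)
Lemma sum_ext_involution (R : zmodType) n (W : seq int)
    (phi : config n -> config n) (F : config n -> R) :
  involutive phi -> (forall eta k, k \notin W -> phi eta k = eta k) ->
  \sum_(xi : {ffun seq_sub W -> 'I_n.+1}) F (phi (ext xi)) =
  \sum_(xi : {ffun seq_sub W -> 'I_n.+1}) F (ext xi).
Proof.
move=> phiK phiW.
pose h (xi : {ffun seq_sub W -> 'I_n.+1}) := restrict W (phi (ext xi)).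
have extS (xi : {ffun seq_sub W -> 'I_n.+1}) k : k \notin W -> ext xi k = ord0.
  by move=> kW; rewrite /ext insubN.
have hE xi : ext (h xi) = phi (ext xi).
  apply/funext => k; have [kW|kW] := boolP (k \in W); first exact: ext_restrict.
  by rewrite phiW// !extS.
have h_inj : injective h.
  move=> xi xi' /(congr1 (@ext n W)); rewrite !hE => /(inv_inj phiK) E.
  by rewrite -[xi]restrict_ext E restrict_ext.
by rewrite [RHS](reindex_inj h_inj); apply: eq_bigr => xi _; rewrite hE.
Qed.

Lemma exchangeK n k : involutive (@exchange n k).
Proof.
move=> eta; apply/funext => j; rewrite /exchange.
have k1k : (k + 1 == k) = false by lia.
have [->|jk] := eqVneq j k; first by rewrite k1k eqxx.
by have [->|//] := eqVneq j (k + 1); rewrite eqxx.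
Qed.

Section Intertwining.
Variables (R : realType) (n N : nat) (w q lambda : R).
Hypotheses (hn : (1 <= n)%N) (q1 : 1 < q).
Variable nu : shock_config n N -> probability (config n) R.
Hypothesis hnu : forall y, shock_measure q lambda y (nu y).
Implicit Types (x y : shock_config n N) (W : seq int) (f : config n -> R).
Local Notation cprob := (current_prob w q nu).
Local Notation window_prob := (window_prob nu).

Lemma Rintegral_shock W f y : uniq W -> depends_on W f ->
  \int[nu y]_eta f eta = \sum_(xi : {ffun seq_sub W -> 'I_n.+1})
    f (ext xi) * window_prob W (ext xi) y.
Proof.
move=> uW fW; rewrite (Rintegral_depends_on _ fW); last exact: probability_setT.
by apply: eq_bigr => xi _; rewrite (fine_nu_cyl hnu).
Qed.

(** Exchanges the two bulk values 0 and [n] at the site [k]. *)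
Definition flip (k : int) (eta : config n) : config n :=
  fun j => if j == k then tperm ord0 ord_max (eta j) else eta j.

(* The signed weight [current x k] has total mass zero: it is odd under the
   exchange of the two bulk values. *)
Lemma sum_current_prob W f x k : uniq W -> k \in W ->
  (forall eta, f (flip k eta) = f eta) ->
  \sum_(xi : {ffun seq_sub W -> 'I_n.+1}) f (ext xi) * cprob W (ext xi) x k = 0.
Proof.
move=> uW kW fk; set S := \sum_xi _.
have flipK : involutive (flip k).
  by move=> eta; apply/funext => j; rewrite /flip; case: eqP => // _; rewrite tpermK.
have flipW eta j : j \notin W -> flip k eta j = eta j.
  by move=> jW; rewrite /flip; case: eqP => // E; rewrite -E (negbTE jW) in kW.
suff : S = - S by move=> E; lra.
rewrite /S -[LHS](sum_ext_involution (fun eta => f eta * cprob W eta x k) flipK flipW).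
rewrite -sumrN; apply: eq_bigr => xi _; rewrite fk -mulrN; congr (_ * _).
rewrite /current_prob -mulNr; congr (_ * _).
  rewrite /current /flip eqxx -mulrN; congr (_ * _); rewrite opprB.
  set a := ext xi k; case: tpermP => [->|->|/eqP/negbTE a0 /eqP/negbTE am].
  - by rewrite !eqxx [ord_max == _]eq_sym; case: eqP.
  - by rewrite !eqxx [ord_max == _]eq_sym; case: eqP.
  - by rewrite a0 am.
by apply: eq_bigr => l lk; rewrite /flip (negbTE lk).
Qed.

(** Every transition belongs to exactly one bond, so the sum over bonds recovers the generator of
    the chain. *)
Lemma sum_bond_jumps r xi x W : 
  (forall s, transition_bond x s \in window_bonds r) ->
  \sum_(k <- window_bonds r) bond_jumps w q lambda nu W xi x k =
  chain_gen (@target n N) (transition_rate w q lambda) (window_prob W xi) x.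
Proof.
move=> Hs; rewrite /bond_jumps exchange_big/=; apply: eq_bigr => s _.
rewrite (bigD1_seq (transition_bond x s)) ?intv_uniq//= eqxx mul1r big1 ?addr0// => k.
by rewrite eq_sym => /negbTE ->; rewrite mul0r.
Qed.

Lemma shock_intertwining r f x : depends_on (window r) f ->
  \int[nu x]_eta asep_gen w q f eta =
  chain_gen (@target n N) (transition_rate w q lambda)
    (fun y => \int[nu y]_eta f eta) x.
Proof.
move=> fr.
(* Large enough for the bonds inside the window to include those that touch [window r] and those
   where a transition occurs, while the end sites are outside of [window r]. *)
pose r' := (r.+2 + \sum_i absz (pos x i))%N.
have posr' i : (`|pos x i| + 2 <= r')%N.
  by rewrite /r' (bigD1 i)//=; lia.
pose W := window r'; have uW : uniq W by exact: intv_uniq.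
have rW : {subset window r <= W} by move=> k; rewrite !mem_window /r'; lia.
have fW := depends_on_sub rW fr.
have LW : depends_on W (asep_gen w q f).
  apply: (depends_on_sub _ (@depends_on_asep_gen _ _ w q _ _ fr)) => k.
  by rewrite !mem_window /r'; lia.
have bW k : k \in window_bonds r' -> (k \in W) && (k + 1 \in W).
  by rewrite mem_window_bonds.
rewrite (Rintegral_shock _ uW LW).
transitivity (\sum_(k <- window_bonds r')
    \sum_(xi : {ffun seq_sub W -> 'I_n.+1}) f (ext xi) *
      (bond_jumps w q lambda nu W (ext xi) x k + cprob W (ext xi) x k
       - cprob W (ext xi) x (k + 1))).
  rewrite [RHS]big_seq_cond.
  transitivity (\sum_(k <- window_bonds r' | (k \in window_bonds r') && true)
    \sum_(xi : {ffun seq_sub W -> 'I_n.+1})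
      asep_rate w q (ext xi k) (ext xi (k + 1)) *
      (f (exchange k (ext xi)) - f (ext xi)) * window_prob W (ext xi) x).
    rewrite -[RHS]big_seq_cond exchange_big/=; apply: eq_bigr => xi _.
    rewrite (@asep_gen_sum _ _ w q _ (window_bonds r') _ _ fr) ?intv_uniq//.
      by rewrite mulr_suml.
    by move=> k; rewrite mem_window_bonds !mem_window /r'; lia.
  apply: eq_bigr => k /andP[/bW/andP[kW k1W] _].
  under [RHS]eq_bigr do rewrite -(bond_identity w hn q1 hnu _ _ uW kW k1W) mulrBr.
  under [LHS]eq_bigr do rewrite mulrBr mulrBl.
  rewrite !sumrB; congr (_ - _); last by apply: eq_bigr => xi _; ring.
  have exW (eta : config n) j : j \notin W -> exchange k eta j = eta j.
    move=> jW; rewrite /exchange; case: eqP => [E|_]; first by rewrite E kW in jW.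
    by case: eqP => [E|//]; rewrite E k1W in jW.
  (* Summing over exchanged patterns moves the exchange from [f] to the weight and the rate. *)
  rewrite -[LHS](sum_ext_involution (fun eta => asep_rate w q (eta k) (eta (k + 1)) *
    f (exchange k eta) * window_prob W eta x) (@exchangeK n k) exW).
  apply: eq_bigr => xi _; rewrite exchangeK.
  have k1k : (k + 1 == k) = false by lia.
  by rewrite {1 2}/exchange eqxx k1k eqxx; ring.
rewrite exchange_big/=.
transitivity (\sum_(xi : {ffun seq_sub W -> 'I_n.+1})
   (f (ext xi) * chain_gen (@target n N) (transition_rate w q lambda)
      (window_prob W (ext xi)) x
    + (f (ext xi) * cprob W (ext xi) x (- r'%:Z)
       - f (ext xi) * cprob W (ext xi) x r'%:Z))).
  apply: eq_bigr => xi _; rewrite -mulr_sumr -mulrBr -mulrDr; congr (_ * _).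
  under eq_bigr do rewrite -addrA.
  rewrite big_split/= sum_bond_jumps; last first.
    move=> s; rewrite mem_intv.
    by case: s => [[i|i]|[i j]] /=; have := posr' i; lia.
  congr (_ + _); rewrite telescope_intv; congr (_ - current_prob _ _ _ _ _ _ _).
  by lia.
(* [f] does not see the end sites, so the two boundary terms left by the telescoping vanish. *)
have fflip k : (r < `|k|)%N -> forall eta, f (flip k eta) = f eta.
  move=> rk eta; apply: fr => j; rewrite mem_window /flip => jr.
  by case: eqP => // E; rewrite -E in rk; lia.
rewrite big_split sumrB/=.
rewrite !sum_current_prob//; first last.
- by apply: fflip; rewrite /r'; lia.
- by rewrite mem_window; lia.
- by apply: fflip; rewrite /r'; lia.
- by rewrite mem_window; lia.
rewrite subrr addr0 /chain_gen.
under eq_bigr do rewrite mulr_sumr.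
rewrite exchange_big/=; apply: eq_bigr => s _.
rewrite !(Rintegral_shock _ uW fW) -sumrB mulr_sumr.
by apply: eq_bigr => xi _; ring.
Qed.

End Intertwining.

(** * Evolution of the shock measures *)

Section Mixtures.
Context d (T : measurableType d) (R : realType) (I : countType).
Local Open Scope ereal_scope.

(** Sums over [I] are read through its coding by naturals; codes that name no element carry 0. *)
Lemma esum_countable (a : I -> \bar R) : (forall y, 0 <= a y) ->
  \esum_(y in [set: I]) a y = \sum_(i <oo) oapp a 0 (pickle_inv i).
Proof.
move=> a0.
have b0 i : 0 <= oapp a 0 (pickle_inv i) by case: pickle_inv.
rewrite nneseries_esumT//.
transitivity (\esum_(i in [set pickle y | y in [set: I]]) oapp a 0 (pickle_inv i)).
  rewrite (esum_image setT pickle); last by move=> x y _ _ /(pcan_inj pickleK).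
  by apply: eq_esum => y _; rewrite pickleK_inv.
rewrite esum_mkcond; apply: eq_esum => i _; case: ifPn => // /negP ni.
case E: (pickle_inv i) => [y|//]; exfalso; apply: ni; rewrite inE; exists y => //.
by have := @pickle_invK I i; rewrite E.
Qed.

Variables (c : I -> R) (c0 : forall y, (0 <= c y)%R).
Variable m : I -> {measure set T -> \bar R}.

Definition mixture : {measure set T -> \bar R} :=
  mseries (fun i => if pickle_inv i is Some y
    then mscale (NngNum (c0 y)) (m y) else mzero) 0.

Lemma mixtureE A : mixture A = \esum_(y in [set: I]) ((c y)%:E * m y A).
Proof.
rewrite esum_countable; last by move=> y; rewrite mule_ge0// lee_fin.
by apply: eq_eseriesr => i _; case: pickle_inv.
Qed.

Lemma integral_mixture (f : T -> \bar R) : (forall z, 0 <= f z) ->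
  measurable_fun setT f ->
  \int[mixture]_z f z = \esum_(y in [set: I]) ((c y)%:E * \int[m y]_z f z).
Proof.
move=> f0 mf; rewrite ge0_integral_measure_series// esum_countable; last first.
  by move=> y; rewrite mule_ge0 ?lee_fin ?integral_ge0.
apply: eq_eseriesr => i _; case: pickle_inv => [y|] /=.
  by rewrite ge0_integral_mscale.
exact: integral_measure_zero.
Qed.

End Mixtures.

(** Cylinders generate the sigma-algebra and, once the empty set is adjoined, are stable under
    intersection: two cylinders with a common point [eta] meet in the cylinder of [eta] over
    [W ++ W']. *)
Lemma measure_eq_cylinders (R : realType) n
    (m1 m2 : {measure set (config n) -> \bar R}) : (m1 setT < +oo)%E ->
  (forall W xi, m1 (cyl W xi) = m2 (cyl W xi)) ->
  forall A, measurable A -> m1 A = m2 A.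
Proof.
move=> m1T H; pose G := [set A : set (config n) | A = set0 \/ exists W xi, A = cyl W xi].
have cylT : cyl [::] (fun=> ord0 : 'I_n.+1) = setT by apply/seteqP; split.
apply: (measure_unique G (fun=> setT)) => //.
- rewrite eqEsubset; split.
    apply: smallest_sub; first exact: smallest_sigma_algebra.
    move=> _ [k [a ->]]; apply: sub_sigma_algebra; right.
    exists [:: k], (fun=> a); apply/seteqP; split=> [eta /= E j|eta /= E].
      by rewrite inE => /eqP ->.
    by apply: E; rewrite mem_head.
  apply: smallest_sub; first exact: sigma_algebra_measurable.
  by move=> A [->|[W [xi ->]]]; [exact: measurable0|exact: measurable_cyl].
- move=> A B [->|[W [xi ->]]]; first by rewrite set0I; left.
  move=> [->|[W' [xi' ->]]]; first by rewrite setI0; left.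
  have [[eta [E E']]|no] := pselect (exists eta, cyl W xi eta /\ cyl W' xi' eta).
    right; exists (W ++ W'), eta; apply/seteqP; split=> zeta /=.
      move=> [H1 H2] k; rewrite mem_cat => /orP[kW|kW].
        by rewrite H1// E.
      by rewrite H2// E'.
    move=> H3; split=> k kW; rewrite H3 ?mem_cat ?kW ?orbT//.
      exact: E.
    exact: E'.
  by left; apply/seteqP; split=> // eta E; apply: no; exists eta.
- by move=> _; right; exists [::], (fun=> ord0); rewrite cylT.
- by rewrite bigcup_const.
- by move=> A [->|[W [xi ->]]]; [rewrite !measure0|exact: H].
Qed.

(** * The identity for small times on cylinders, then in general *)

Section Evolution.
Variables (R : realType) (n N : nat) (w q lambda : R).
Hypotheses (hn : (1 <= n)%N) (w0 : 0 < w) (q1 : 1 < q).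
Variable P : R -> R.-pker (config n) ~> (config n).
Hypothesis hP : priority_asep w q P.
Variable nu : shock_config n N -> probability (config n) R.
Hypothesis hnu : forall y, shock_measure q lambda y (nu y).
Variable p : R -> shock_config n N -> shock_config n N -> R.
Hypothesis hp : ctmc (shock_rate w q lambda) p.
Implicit Types (x y : shock_config n N) (W : seq int) (t s h : R).
Local Notation gen := (chain_gen (@target n N) (transition_rate w q lambda)).

Let q0 : 0 < q := lt_trans ltr01 q1.

(** The sum of the growth constants of the iterates of the two generators, hence a common bound for
    both. *)
Definition growth_rate : R := 8 * w * q + 2 * total_rate_bound N w q lambda.

Lemma growth_rate_gt0 : 0 < growth_rate.
Proof.
rewrite /growth_rate ltr_pwDl ?mulr_gt0//.
by rewrite mulr_ge0//; exact: total_rate_bound_ge0.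
Qed.

Lemma iter_intertwining r (f : config n -> R) k x : depends_on (window r) f ->
  \int[nu x]_eta iter k (asep_gen w q) f eta =
  iter k gen (fun y => \int[nu y]_eta f eta) x.
Proof.
move=> fr; elim: k x => [//|k IH] x.
rewrite iterS (shock_intertwining w hn q1 hnu _ (@iter_asep_gen_depends_on _ _ w q _ _ k fr)).
by rewrite iterS; congr (gen _ x); apply/funext => y; exact: IH.
Qed.

Lemma cyl_evolution W xi x t : 0 <= t -> growth_rate * t < 1 ->
  (law P (nu x) t (cyl W xi) =
   \esum_(y in [set: shock_config n N]) ((p t x y)%:E * nu y (cyl W xi)))%E.
Proof.
move=> t0 Kt.
pose f : config n -> R := \1_(cyl W xi).
pose r := \max_(k <- W) `|k|%N.
have fr : depends_on (window r) f.
  apply: depends_on_sub (depends_on_cyl R xi) => k kW.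
  by rewrite mem_window /r (big_rem k)//= leq_maxl.
have f1 eta : `|f eta| <= 1.
  by rewrite /f indicE normr_nat lern1 leq_b1.
have nuT y : nu y setT = 1%E by exact: probability_setT.
pose g y := \int[nu y]_eta f eta.
have gE y : g y = fine (nu y (cyl W xi)) by rewrite /g Rintegral_cyl.
have g01 y : 0 <= g y <= 1.
  rewrite gE fine_ge0//= -lee_fin fineK; last exact: (mu_cyl_fin (nuT y)).
  by rewrite probability_le1//; exact: measurable_cyl.
have rT := @shock_rate_targets R n N w q lambda.
(* The two evolutions of the [k]-th iterate; the forward equation differentiates the first term, the
   backward equation the second. *)
pose phi k s := \int[law P (nu x) s]_eta iter k (asep_gen w q) f eta
  + -1 * iter k gen (transport p g s) x.
have phi_deriv k : unif_rderiv (phi k) (phi k.+1).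
  apply: unif_rderivD.
    exact: law_rderiv hP (@iter_asep_gen_depends_on _ _ w q _ _ k fr).
  by apply: unif_rderivZ; exact: (iter_transport_rderiv rT hp g01).
(* At time 0 this is the iterated intertwining relation. *)
have phi0 k : phi k 0 = 0.
  rewrite /phi.
  have -> : transport p g 0 = g by apply/funext => y; rewrite (transport0 hp g01).
  have -> : \int[law P (nu x) 0]_eta iter k (asep_gen w q) f eta =
      \int[nu x]_eta iter k (asep_gen w q) f eta.
    by congr fine; apply: eq_measure_integral => A mA _; exact: (law0 _ hP.1).
  by rewrite (iter_intertwining _ _ fr) mulN1r subrr.
have cge0 := total_rate_bound_ge0 N lambda w0 q1.
(* [2 ^+ r] comes from the exclusion process, 1 from the chain, whose function [transport p g s] is
   bounded by 1. *)
have phi_bound k s : 0 <= s ->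
    `|phi k s| <= (2 ^+ r + 1) * growth_rate ^+ k * k`!%:R.
  move=> s0; apply: le_trans (ler_normD _ _) _.
  have -> : (2 ^+ r + 1) * growth_rate ^+ k * k`!%:R =
    2 ^+ r * growth_rate ^+ k * k`!%:R + growth_rate ^+ k * k`!%:R :> R by ring.
  have K0 := ltW growth_rate_gt0.
  have a0 : 0 <= 8 * w * q by rewrite !mulr_ge0 ?(ltW w0) ?(ltW q0).
  have c20 : 0 <= 2 * total_rate_bound N w q lambda by rewrite mulr_ge0.
  rewrite mulN1r normrN; apply: lerD.
    apply: (@le_trans _ _ (2 ^+ r * 1 * (8 * w * q) ^+ k * k`!%:R)).
      apply: norm_Rintegral_depends_on.
      - exact: law_setT.
      - exact: (@iter_asep_gen_depends_on _ _ w q _ _ k fr).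
      - by move=> eta; exact: (iter_asep_gen_bound w0 q1).
    rewrite mulr1 ler_wpM2r// ler_wpM2l ?exprn_ge0// lerXn2r ?nnegrE//.
    by rewrite lerDl.
  have u1 y : `|transport p g s y| <= 1.
    by have /andP[u0 u1] := transport01 hp g01 y s0; rewrite ger0_norm.
  have B := iter_chain_gen_bound (@target n N) (@transition_rate_ge0 _ n N w q lambda w0 q1)
    (sum_transition_rate lambda w0 q1) u1 k x.
  apply: le_trans B _.
  apply: (@le_trans _ _ (growth_rate ^+ k)).
    by rewrite mulr1 lerXn2r ?nnegrE// lerDr.
  by rewrite ler_peMr ?exprn_ge0// ler1n fact_gt0.
have := factorial_growth_eq0 (ltW growth_rate_gt0) phi_deriv phi0 phi_bound t0 Kt.
rewrite /phi/= mulN1r => /eqP; rewrite subr_eq0 => /eqP E.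
have lT := law_setT P (nu x) t.
rewrite -[LHS]fineK; last exact: mu_cyl_fin.
rewrite -Rintegral_cyl E -(transportE hp g01)//.
by apply: eq_esum => y _; rewrite EFinM gE fineK// (mu_cyl_fin (nuT y)).
Qed.

Definition evolves_at t := forall x A, measurable A ->
  (law_at P (nu x) t A = \esum_(y in [set: shock_config n N]) ((p t x y)%:E * nu y A))%E.

(** The same carrier as [shock_config], with the countable structure that mixtures require. *)
Let shock_countType : countType :=
  {c : {ffun 'I_N -> int} * {ffun 'I_N -> 'I_n} | increasing_pos c.1}.

Let shock_mixture t x (t0 : 0 <= t) :=
  mixture (I := shock_countType) (fun y => ctmc_ge0 hp x y t0) (fun y => nu y).

Lemma evolves_small t : 0 <= t -> growth_rate * t < 1 -> evolves_at t.
Proof.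
move=> t0 Kt x A mA.
transitivity (shock_mixture x t0 A); last exact: mixtureE.
apply: (measure_eq_cylinders (m1 := law P (nu x) t)) => //.
  by rewrite law_setT ltry.
by move=> W xi; rewrite (cyl_evolution W xi x t0 Kt) mixtureE.
Qed.

(** At time [s] the law is a mixture of shock measures; each of them evolves for a time [h], and
    Chapman-Kolmogorov for [p] recombines the weights. *)
Lemma evolves_add s h : 0 <= s -> 0 <= h ->
  evolves_at s -> evolves_at h -> evolves_at (s + h).
Proof.
move=> s0 h0 Es Eh x A mA.
have mP : measurable_fun setT (fun z => P h z A) by exact: measurable_kernel.
rewrite -lawE (law_add _ hP.1)//.
transitivity (\int[shock_mixture x s0]_z P h z A)%E.
  apply: eq_measure_integral => B mB _.
  by rewrite mixtureE; exact: Es.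
rewrite integral_mixture//.
transitivity (\esum_(y in [set: shock_config n N])
    \esum_(z in [set: shock_config n N]) ((p s x y)%:E * ((p h y z)%:E * nu z A)))%E.
  apply: eq_esum => y _; rewrite (Eh y A mA : (\int[nu y]_z P h z A = _)%E) muleC.
  rewrite -esumMr; last 2 first.
  - by move=> z; rewrite mule_ge0// lee_fin (ctmc_ge0 hp).
  - exact: ctmc_ge0 hp _ _ _ s0.
  by apply: eq_esum => z _; rewrite muleC.
rewrite esum_swap; last first.
  by move=> y z; rewrite !mule_ge0// lee_fin (ctmc_ge0 hp).
apply: eq_esum => z _; rewrite (ctmc_chapman_kolmogorov hp)//.
have nufin : nu z A \is a fin_num by exact: fin_num_measure.
rewrite -(fineK nufin) -esumMr//; last 2 first.
- by move=> y; rewrite lee_fin mulr_ge0// (ctmc_ge0 hp).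
- by rewrite fine_ge0.
by apply: eq_esum => y _; rewrite EFinM muleA.
Qed.

Lemma evolves t : 0 <= t -> evolves_at t.
Proof.
move=> t0; have K0 := growth_rate_gt0.
(* [m] exceeds [growth_rate * t], so each of the [m] steps of length [t / m] is in the range of
   small times. *)
pose m := (Num.truncn (growth_rate * t)).+1.
have m0 : (0 : R) < m%:R by rewrite ltr0n.
pose s := t / m%:R; have s0 : 0 <= s by rewrite divr_ge0.
have Es : evolves_at s.
  by apply: evolves_small => //; rewrite mulrA ltr_pdivrMr// mul1r truncnS_gt.
suff Ek (k : nat) : evolves_at (k%:R * s).
  by have -> : t = m%:R * s by rewrite mulrC divfK ?gt_eqF.
elim: k => [|k IH]; first by rewrite mul0r; apply: evolves_small => //; rewrite mulr0 ltr01.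
by rewrite -natr1 mulrDl mul1r; apply: evolves_add => //; rewrite mulr_ge0.
Qed.

End Evolution.

Theorem theorem3p12 (R : realType) (n N : nat) (w q lambda : R)
    (hn : (1 <= n)%N) (hN : (1 <= N)%N) (hw : 0 < w) (hq : 1 < q)
    (P : R -> R.-pker (config n) ~> (config n))
    (hP : priority_asep w q P)
    (nu : shock_config n N -> probability (config n) R)
    (hnu : forall y, shock_measure q lambda y (nu y))
    (p : R -> shock_config n N -> shock_config n N -> R)
    (hp : ctmc (shock_rate w q lambda) p)
    (x : shock_config n N) (t : R) (ht : 0 <= t)
    (A : set (config n)) (hA : measurable A) :
  law_at P (nu x) t A =
  (\esum_(y in [set: shock_config n N]) ((p t x y)%:E * nu y A))%E.
Proof. exact: (evolves hn hw hq hP hnu hp ht x hA). Qed.
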